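(* Let $C\subset\mathbb{R}^2$ be a smooth plane curve, i.e. a 1-dimensional, smooth, properly embedded submanifold of $\mathbb{R}^2$, let $\alpha$ be the measure on $\mathbb{R}^2$ supported on $C$ and induced by arc length, and let $x\in C$. Then, for $\sigma>0$ small (as $\sigma\to0^+$), the covariance tensor associated with the truncation kernel, written as a matrix in the tangent–normal coordinates at $x$, is $$\Sigma_\alpha(x,\sigma)=\begin{pmatrix}\frac{2\sigma}{3\pi}-\frac{\kappa^2\sigma^3}{20\pi}+O(\sigma^4)&\frac{\kappa_s\sigma^3}{15\pi}+O(\sigma^4)\\[4pt]\frac{\kappa_s\sigma^3}{15\pi}+O(\sigma^4)&\frac{\kappa^2\sigma^3}{10\pi}+O(\sigma^4)\end{pmatrix},$$ where $\kappa$ and $\kappa_s$ are the curvature of $C$ and its arc-length derivative at $x$.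
   Context: The truncation kernel on $\mathbb{R}^2$ is $T(x,y,\sigma)=\frac{1}{\pi\sigma^2}$ if $\|y-x\|\le\sigma$ and $0$ otherwise. For a locally finite Borel measure $\alpha$ on $\mathbb{R}^2$, $\Sigma_\alpha(x,\sigma)=\int(y-x)\otimes(y-x)\,T(x,y,\sigma)\,\alpha(dy)$, identified with the matrix $\int(y-x)(y-x)^TT(x,y,\sigma)\,\alpha(dy)$. Tangent–normal coordinates at $x$: the orthonormal coordinates $(X,Y)$ centered at $x$ along the unit tangent and the unit normal of $C$ at $x$, in which the arc-length parametrization of $C$ near $x$ (with $s=0$ at $x$) reads $X(s)=s-\frac{\kappa^2s^3}{6}+O(s^4)$, $Y(s)=\frac{\kappa s^2}{2}+\frac{\kappa_ss^3}{6}+O(s^4)$, where $\kappa$ is the (signed) curvature and $\kappa_s$ its derivative with respect to arc length, both evaluated at $x$. *)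

(* Defs.v *)
(* The plane is [R * R].  Its topology is the usual one, but the library norm on
   it is the sup norm, hence the explicit Euclidean norm below.  Its measurable
   structure is the product sigma-algebra of the Borel sigma-algebras of the two
   factors, that is, the Borel sigma-algebra of the plane. *)
From HB Require Import structures.
From mathcomp Require Import all_boot all_order all_algebra.
From mathcomp Require Import all_classical all_reals all_analysis.
Import Order.TTheory GRing.Theory Num.Theory.
Import numFieldNormedType.Exports.

Set Implicit Arguments.
Unset Strict Implicit.
Unset Printing Implicit Defensive.

Local Open Scope ring_scope.
Local Open Scope classical_set_scope.

Section EuclideanPlane.
Variable R : realType.
Implicit Types u v x y : R * R.

Definition dot2 u v : R := u.1 * v.1 + u.2 * v.2.

Definition enorm v : R := Num.sqrt (dot2 v v).

(* Rotation by a right angle, counterclockwise. *)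
Definition rot90 v : R * R := (- v.2, v.1).

Definition col2 v : 'cV[R]_2 := \col_(i < 2) (if i == 0 then v.1 else v.2).

End EuclideanPlane.

Section Curves.
Variable R : realType.
Implicit Types (C : set (R * R)) (a b : R) (gamma : R -> R * R).

(* [gamma] is an arbitrary total function; only its values on the open interval
   ]a, b[ matter. *)
Definition smooth_on a b gamma : Prop :=
  forall (n : nat) (t : R), a < t < b -> derivable (gamma^`(n)) t 1.

Definition speed gamma (t : R) : R := enorm (gamma^`() t).

(* [gamma] is a smooth immersion of ]a, b[ and a homeomorphism (with inverse g)
   from ]a, b[ onto a relatively open subset of [C]. *)
Definition local_parametrization C a b gamma : Prop :=
  [/\ smooth_on a b gamma,
      forall t, a < t < b -> gamma^`() t != 0 &
      exists (U : set (R * R)) (g : R * R -> R),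
        [/\ open U,
            gamma @` `]a, b[ = C `&` U,
            forall t, a < t < b -> g (gamma t) = t &
            {within C `&` U, continuous g}]].

Definition embedded_curve C : Prop :=
  forall p, C p -> exists a b gamma,
    local_parametrization C a b gamma /\ (gamma @` `]a, b[) p.

(* The last clause says that the inclusion of [C] in the plane is proper. *)
Definition smooth_plane_curve C : Prop :=
  embedded_curve C /\ (forall K, compact K -> compact (C `&` K)).

(* The measure carried by [C] which, in every local parametrization, is given by
   the arc length element |gamma'(t)| dt.  As [C] is covered by countably many
   such parametrizations, this determines [alpha]. *)
Definition arc_length_measure C (alpha : {measure set (R * R) -> \bar R}) : Prop :=
  alpha.-negligible (~` C) /\
  forall a b gamma, local_parametrization C a b gamma ->
  forall A : set (R * R), measurable A ->
    alpha (A `&` gamma @` `]a, b[) =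
    (\int[lebesgue_measure]_(t in `]a, b[ `&` gamma @^-1` A)
       (speed gamma t)%:E)%E.

Definition arc_length_parametrization C a b gamma : Prop :=
  local_parametrization C a b gamma /\
  forall t, a < t < b -> speed gamma t = 1.

(* The tangent, the normal, the signed curvature and its derivative are meant for
   curves parametrized by arc length.  The frame is positively oriented; reversing
   the parametrization flips the tangent, the normal and the sign of the
   curvature, and leaves [curvature_s] unchanged. *)
Definition unit_tangent gamma (s : R) : R * R := gamma^`() s.

Definition unit_normal gamma (s : R) : R * R := rot90 (unit_tangent gamma s).

Definition curvature gamma (s : R) : R := dot2 (gamma^`(2) s) (unit_normal gamma s).

Definition curvature_s gamma (s : R) : R := ((curvature gamma)^`())%classic s.

(* The matrix whose columns are the unit tangent and the unit normal. *)
Definition frame gamma (s : R) : 'M[R]_2 :=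
  row_mx (col2 (unit_tangent gamma s)) (col2 (unit_normal gamma s)).

End Curves.

Section Covariance.
Variable R : realType.

Definition truncation_kernel (x y : R * R) (sigma : R) : R :=
  if enorm (y - x) <= sigma then (pi * sigma ^+ 2)^-1 else 0.

Definition covariance_tensor (alpha : {measure set (R * R) -> \bar R})
    (x : R * R) (sigma : R) : 'M[R]_2 :=
  \matrix_(i < 2, j < 2)
    \int[alpha]_(y in setT)
      ((col2 (y - x) *m (col2 (y - x))^T) i j * truncation_kernel x y sigma).

(* If the columns of the orthogonal matrix [P] are an orthonormal basis (e_i),
   the entries of this matrix are e_i^T Sigma e_j. *)
Definition in_frame (P Sigma : 'M[R]_2) : 'M[R]_2 := P^T *m Sigma *m P.

End Covariance.

(* Main.v *)
(* In the coordinates w = gamma - x, an arc-length parametrization satisfies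
   |w(t)|^2 = t^2 - m t^4 + O(t^5) with m = kappa^2 / 12, so the parameters t for
   which gamma(t) lies in the disk of radius sigma form a set squeezed between two
   symmetric intervals of radii sigma + m sigma^3 / 2 -+ M sigma^4.  On the disk,
   alpha is the image of Lebesgue measure under gamma, hence each entry of the
   covariance tensor is 1 / (pi sigma^2) times the integral over that set of
   w_i w_j = c2 t^2 + c3 t^3 + c4 t^4 + O(t^5), that is,
   (2 c2 / 3 sigma^3 + (c2 m + 2 c4 / 5) sigma^5 + O(sigma^6)) / (pi sigma^2):
   the term c2 m comes from the length of the set, and c3 disappears by symmetry. *)

Require Import Defs.
From HB Require Import structures.
From mathcomp Require Import all_boot all_order all_algebra.
From mathcomp Require Import all_classical all_reals all_analysis.
From mathcomp Require Import measurable_realfun ring lra.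
Import Order.TTheory GRing.Theory Num.Theory.
Import numFieldNormedType.Exports.
Local Open Scope ring_scope.
Local Open Scope classical_set_scope.

(** * Taylor expansion and derivatives along a unit-speed curve *)

(** The value of m comes from adding the squares of the two coordinates: the tangential one
    contributes -kappa^2 / 3 to the coefficient of t^4, the normal one kappa^2 / 4, and the sum is
    -kappa^2 / 12. A Taylor expansion of order 3 is precise enough because each remainder O(t^4)
    gets multiplied by a coordinate of w, itself O(t). Two obstacles are not analytic. The curve
    could come back close to [x], at a far parameter or along another piece of [C]; this is excluded
    by the relative openness of the parametrized piece and by the continuity of the inverse
    parametrization. Moreover [alpha] is prescribed on measurable sets only, so the part of [C] in a
    disk must be shown measurable, which is where properness enters. All expansions are made in the
    fixed coordinates of the plane, where every entry has a leading term T_i T_j and a cubic term.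
    The tangent-normal frame enters only at the end, by contraction with T and N, and this is what
    separates the four entries. *)

Lemma derivable_lipschitz_at0 (R : realType) (f : R -> R) :
  derivable f 0 1 ->
  exists2 K, 0 <= K & \forall t \near (0 : R), `|f t - f 0| <= K * `|t|.
Proof.
(* Near 0 the difference quotient is within 1 of its limit [l]. *)
move=> /cvg_ex[/= l fl]; exists (`|l| + 1); first by rewrite addr_ge0.
move/cvgrPdist_lt : fl => /(_ 1 ltr01).
rewrite !near_withinE => fl; near=> t.
have [t00|t0] := eqVneq t 0; first by rewrite t00 subrr !normr0 mulr0.
have : t != 0 -> `|l - t^-1 *: (f (t *: 1 + 0) - f 0)| < 1.
  by near: t; exact: fl.
move=> /(_ t0); rewrite addr0 /GRing.scale /= mulr1 => lf.
rewrite -ler_pdivrMr ?normr_gt0// -normfV -normrM mulrC.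
rewrite -[X in `|X|](subrK l) (le_trans (ler_normD _ _))// addrC lerD2l.
by rewrite distrC ltW.
Unshelve. all: by end_near. Qed.

(** The mean value theorem replaces integration: f(t) = df(c) t with |c| <= |t|. The factor 1 / (n +
    1) is given up, so the same [K] serves at every order. *)
Lemma derive_bound_integrate (R : realType) (f df : R -> R) (r K : R) (n : nat) :
  0 <= K -> (forall t : R, `|t| <= r -> is_derive t 1 f (df t)) -> f 0 = 0 ->
  (forall t, `|t| <= r -> `|df t| <= K * `|t| ^+ n) ->
  forall t, `|t| <= r -> `|f t| <= K * `|t| ^+ n.+1.
Proof.
move=> K0 fdf f0 bdf t tr.
suff [c ct ->] : exists2 c, `|c| <= `|t| & f t = df c * t.
  rewrite normrM exprSr mulrA ler_wpM2r//.
  apply: le_trans (bdf c (le_trans ct tr)) _.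
  by rewrite ler_wpM2l// lerXn2r// ?nnegrE.
have cf (u v : R) : (forall s, s \in `[u, v]%R -> `|s| <= r) ->
    {within `[u, v], continuous f}.
  move=> uv; apply: derivable_within_continuous => s suv.
  by have [] := fdf s (uv s suv).
have [t0|t0] := leP 0 t.
  have tK s : s \in `[0, t]%R -> `|s| <= `|t|.
    by rewrite in_itv/= => /andP[s0 st]; rewrite !ger0_norm.
  have [s st||c /tK ct fc] := @MVT_segment R f df 0 t t0.
  - by apply/fdf/(le_trans _ tr)/tK/subset_itv_oo_cc.
  - by apply: cf => s /tK /le_trans; apply.
  - by exists c => //; rewrite -[LHS]subr0 -f0 fc subr0.
have tK s : s \in `[t, 0]%R -> `|s| <= `|t|.
  by rewrite in_itv/= => /andP[s0 st]; rewrite !ler0_norm ?lerN2// ltW.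
have [s st||c /tK ct fc] := @MVT_segment R f df t 0 (ltW t0).
- by apply/fdf/(le_trans _ tr)/tK/subset_itv_oo_cc.
- by apply: cf => s /tK /le_trans; apply.
- by exists c => //; apply: oppr_inj; rewrite -mulrN -[- f t]add0r -[X in X - _]f0 fc sub0r.
Qed.

(** [F n] stands for the n-th derivative. The remainder of each [F n] is an antiderivative,
    vanishing at 0, of the remainder of the next one; the chain starts from the Lipschitz bound at 0
    on the third derivative. *)
Lemma taylor_order3 (R : realType) (F : nat -> R -> R) (a b : R) :
  a < 0 < b -> (forall n (t : R), a < t < b -> is_derive t 1 (F n) (F n.+1 t)) ->
  exists r K : R, [/\ 0 < r, 0 <= K, forall t, `|t| <= r -> a < t < b &
    forall t, `|t| <= r ->
      `|F 0%N t - (F 0%N 0 + F 1%N 0 * t + F 2%N 0 / 2 * t ^+ 2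
                   + F 3%N 0 / 6 * t ^+ 3)| <= K * `|t| ^+ 4].
Proof.
move=> /[dup] ab0 /andP[a0 b0] dF.
have [K K0 /nbhs_ballP[e /= e0 eK]] : exists2 K, 0 <= K &
    \forall t \near (0 : R), `|F 3%N t - F 3%N 0| <= K * `|t|.
  by apply: derivable_lipschitz_at0; have [] := dF 3%N 0 ab0.
pose r := Num.min (e / 2) (Num.min (- a / 2) (b / 2)).
have r0 : 0 < r by rewrite !lt_min; apply/and3P; split; lra.
have rab t : `|t| <= r -> a < t < b.
  by rewrite !le_min !ler_norml => /and3P[_ /andP[? ?] /andP[? ?]]; apply/andP; lra.
exists r, K; split => // t tr.
have step n (f df : R -> R) : (forall t : R, `|t| <= r -> is_derive t 1 f (df t)) ->
    f 0 = 0 -> (forall t, `|t| <= r -> `|df t| <= K * `|t| ^+ n) ->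
    forall t, `|t| <= r -> `|f t| <= K * `|t| ^+ n.+1.
  by move=> ? ? ?; exact: derive_bound_integrate.
have b3 s : `|s| <= r -> `|F 3%N s - F 3%N 0| <= K * `|s| ^+ 1.
  move=> sr; rewrite expr1; apply: eK => /=.
  rewrite /ball/= sub0r normrN (le_lt_trans sr)// /r gt_min; apply/orP; left; lra.
have b2 := step 1%N (fun s => F 2%N s - (F 2%N 0 + F 3%N 0 * s))
  (fun s => F 3%N s - F 3%N 0).
have b1 := step 2%N (fun s => F 1%N s - (F 1%N 0 + F 2%N 0 * s + F 3%N 0 / 2 * s ^+ 2))
  (fun s => F 2%N s - (F 2%N 0 + F 3%N 0 * s)).
apply: (step 3%N (fun s => F 0%N s - (F 0%N 0 + F 1%N 0 * s + F 2%N 0 / 2 * s ^+ 2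
                   + F 3%N 0 / 6 * s ^+ 3))
  (fun s => F 1%N s - (F 1%N 0 + F 2%N 0 * s + F 3%N 0 / 2 * s ^+ 2))) => //.
- move=> s sr; have ? := dF 0%N s (rab s sr).
  by apply: is_derive_eq; rewrite /GRing.scale/= ?expr1 ; field.
- by ring.
apply: b1.
- move=> s sr; have ? := dF 1%N s (rab s sr).
  by apply: is_derive_eq; rewrite /GRing.scale/= ?expr1; field.
- by ring.
apply: b2 => //.
- move=> s sr; have ? := dF 2%N s (rab s sr).
  by apply: is_derive_eq; rewrite /GRing.scale/= ?expr1; field.
- by ring.
Qed.

Lemma is_derive_fst_snd (R : realType) (gamma : R -> R * R) (t : R) :
  derivable gamma t 1 ->
  is_derive t 1 (fun s => (gamma s).1) (gamma^`() t).1 /\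
  is_derive t 1 (fun s => (gamma s).2) (gamma^`() t).2.
Proof.
rewrite derive1E => dg.
have proj (p : R * R -> R) : continuous p -> (forall k u v, p (k *: (u - v)) = k *: (p u - p v)) ->
    is_derive t 1 (p \o gamma) (p ('D_1 gamma t)).
  move=> cp lp.
  have pg : (h^-1 *: ((p \o gamma) (h *: 1 + t) - (p \o gamma) t))
      @[h --> (0 : R)^'] --> p ('D_1 gamma t).
    have := cvg_comp _ _ dg (cp ('D_1 gamma t)).
    apply: cvg_trans; apply: near_eq_cvg; near=> h.
    by rewrite /= lp.
  split; first by apply/cvg_ex; exists (p ('D_1 gamma t)).
  exact: cvg_lim pg.
split; apply: proj => //; first [exact: fst_continuous | exact: snd_continuous | move=> z; exact: cvg_fst | move => z; exact: cvg_snd].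
Unshelve. all: by end_near. Qed.

Lemma is_derive_mulD (R : realType) (f1 f2 h1 h2 : R -> R)
    (t df1 df2 dh1 dh2 : R) :
  is_derive t 1 f1 df1 -> is_derive t 1 f2 df2 ->
  is_derive t 1 h1 dh1 -> is_derive t 1 h2 dh2 ->
  is_derive t 1 (fun s => f1 s * h1 s + f2 s * h2 s)
    (df1 * h1 t + df2 * h2 t + (f1 t * dh1 + f2 t * dh2)).
Proof.
by move=> ? ? ? ?; apply: is_derive_eq; rewrite /GRing.scale/=; ring.
Qed.

Lemma dot2C (R : realType) (u v : R * R) : dot2 u v = dot2 v u.
Proof. by rewrite /dot2 mulrC (mulrC u.2). Qed.

(** Expansion in the orthonormal basis (u, rot90 u). Once v is multiplied by |u|^2 = 1, it is a
    polynomial identity. *)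
Lemma dot2_rot90_decomposition (R : realType) (u v : R * R) : dot2 u u = 1 ->
  v = dot2 u v *: u + dot2 v (rot90 u) *: rot90 u.
Proof.
case: u v => [u1 u2] [v1 v2]; rewrite /dot2 /rot90 /= => u_unit.
congr (_, _).
- by rewrite /= /GRing.scale/= -[LHS]mul1r -u_unit; ring.
- by rewrite /= /GRing.scale/= -[LHS]mul1r -u_unit; ring.
Qed.

(** * Frenet formulas up to the third derivative, with [G n] in the role of the n-th derivative *)

Section Jets.
Variables (R : realType) (a b : R) (G : nat -> R -> R * R).
Hypothesis dG1 : forall n (t : R), a < t < b ->
  is_derive t 1 (fun s => (G n s).1) (G n.+1 t).1.
Hypothesis dG2 : forall n (t : R), a < t < b ->
  is_derive t 1 (fun s => (G n s).2) (G n.+1 t).2.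
Hypothesis unit_speed : forall t, a < t < b -> dot2 (G 1%N t) (G 1%N t) = 1.

Lemma is_derive_dot2 n m (t : R) : a < t < b ->
  is_derive t 1 (fun s => dot2 (G n s) (G m s))
    (dot2 (G n.+1 t) (G m t) + dot2 (G n t) (G m.+1 t)).
Proof.
move=> tab; exact: (is_derive_mulD _ _ _ _ _ _ _ _ _ _
  (dG1 n t tab) (dG2 n t tab) (dG1 m t tab) (dG2 m t tab)).
Qed.

Lemma derive_cst_on (f df : R -> R) (c t : R) :
  (forall s : R, a < s < b -> is_derive s 1 f (df s)) ->
  (forall s, a < s < b -> f s = c) -> a < t < b -> df t = 0.
Proof.
move=> fdf fc tab; have [_ <-] := fdf t tab.
rewrite -(derive_cst (c : R) t 1); apply: near_eq_derive.
have : t \in `]a, b[%R by rewrite in_itv.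
by move=> /near_in_itvoo; apply: filterS => s; rewrite in_itv/= => /fc.
Qed.

Lemma dot2_d1_d2 t : a < t < b -> dot2 (G 1%N t) (G 2%N t) = 0.
Proof.
move=> tab; have := derive_cst_on _ _ _ _ (is_derive_dot2 1 1) unit_speed tab.
by move/eqP; rewrite dot2C -mulr2n mulrn_eq0 => /eqP.
Qed.

(** Obtained by differentiating the relation [dot2_d1_d2], which itself comes from differentiating
    |G 1|^2 = 1. *)
Lemma dot2_d1_d3 t : a < t < b ->
  dot2 (G 1%N t) (G 3%N t) = - dot2 (G 2%N t) (G 2%N t).
Proof.
move=> tab; have := derive_cst_on _ _ _ _ (is_derive_dot2 1 2) dot2_d1_d2 tab.
by move/eqP; rewrite addrC addr_eq0 => /eqP.
Qed.

Let kappa s := dot2 (G 2%N s) (rot90 (G 1%N s)).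

Lemma second_derivative_normal t : a < t < b ->
  G 2%N t = kappa t *: rot90 (G 1%N t).
Proof.
move=> tab; rewrite [LHS](dot2_rot90_decomposition _ _ _ (unit_speed t tab)).
by rewrite dot2_d1_d2// scale0r add0r.
Qed.

(** In the product rule, the term where the normal is differentiated pairs [G 2] with its own
    rotation and vanishes. *)
Lemma derive_kappa t : a < t < b ->
  (kappa^`())%classic t = dot2 (G 3%N t) (rot90 (G 1%N t)).
Proof.
move=> tab; rewrite derive1E.
have [_ ->] := is_derive_mulD _ _ _ _ _ _ _ _ _ _
  (dG1 2 t tab) (dG2 2 t tab) (is_deriveN (dG2 1 t tab)) (dG1 1 t tab).
by rewrite /dot2 /rot90 !fctE/=; ring.
Qed.

(** The tangential component is -|G 2|^2, which is -kappa^2 since [G 2] is kappa times a unit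
    normal. These two components are the coefficients of s^3 / 6 in the expansions of X and Y. *)
Lemma third_derivative_frame t : a < t < b ->
  G 3%N t = - kappa t ^+ 2 *: G 1%N t
            + (kappa^`())%classic t *: rot90 (G 1%N t).
Proof.
move=> tab; rewrite [LHS](dot2_rot90_decomposition _ _ _ (unit_speed t tab)).
rewrite derive_kappa// dot2_d1_d3// second_derivative_normal//.
congr (- _ *: _ + _).
have := unit_speed t tab.
move: (kappa t) (G 1%N t) => k [u1 u2]; rewrite /dot2/= => u_unit.
by rewrite -[RHS]mulr1 -u_unit /GRing.scale/=; ring.
Qed.

End Jets.

Lemma dot2_unit_speed (R : realType) (gamma : R -> R * R) (t : R) :
  speed gamma t = 1 -> dot2 (gamma^`() t) (gamma^`() t) = 1.
Proof.
rewrite /speed/enorm => h; rewrite -[LHS]sqr_sqrtr ?h ?expr1n// /dot2 -!expr2.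
by rewrite addr_ge0// sqr_ge0.
Qed.

(** * The parameters of the points of a small disk *)

(* Here [s] plays the role of |t|: a first crude bound s <= 2 sigma is fed back twice
   into s^2 <= sigma^2 + m s^4 + K s^5. *)
Lemma chord_radius_upper (R : realType) (m K r0 A B M sigma s : R) :
  0 <= m -> 0 <= K -> 0 <= s -> 0 < sigma -> sigma <= 1 ->
  s <= r0 -> r0 <= 1 -> (m + K) * r0 <= 3 / 4 ->
  A = 16 * m + 32 * K -> B = m * (2 * A + A ^+ 2) + 32 * K -> B <= 2 * M ->
  s ^+ 2 - m * s ^+ 4 - K * s ^+ 5 <= sigma ^+ 2 ->
  s <= sigma + m / 2 * sigma ^+ 3 + M * sigma ^+ 4.
Proof.
move=> m0 K0 s0 sg0 sg1 sr0 r01 mKr0 AE BE BM q.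
have A0 : 0 <= A by rewrite AE; lra.
have B0 : 0 <= B by rewrite BE; have := sqr_ge0 A => ?; nra.
have r00 : 0 <= r0 := le_trans s0 sr0.
have s20 : 0 <= s ^+ 2 by apply: exprn_ge0.
have pw n : 0 <= sigma ^+ n by apply: exprn_ge0; lra.
have pw1 n : sigma ^+ n.+1 <= sigma ^+ n by rewrite exprS ler_piMl.
(* Since s <= r0 <= 1, the two correction terms are at most (m + K) r0 s^2 <= 3/4 s^2, which leaves
   s^2 / 4 <= sigma^2: hence the constant 3/4. *)
have s_2sg : s <= 2 * sigma.
  have s1 : s <= 1 by lra.
  have s4 : s ^+ 4 <= r0 * s ^+ 2.
    have -> : s ^+ 4 = s ^+ 2 * s ^+ 2 by ring.
    by apply: ler_wpM2r => //; rewrite expr2; nra.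
  have s5 : s ^+ 5 <= r0 * s ^+ 2.
    have -> : s ^+ 5 = s * s ^+ 4 by ring.
    apply: le_trans s4; rewrite ler_piMl//; exact: exprn_ge0.
  have h1 : m * s ^+ 4 <= m * (r0 * s ^+ 2) by apply: ler_wpM2l.
  have h2 : K * s ^+ 5 <= K * (r0 * s ^+ 2) by apply: ler_wpM2l.
  have h3 : (m + K) * r0 * s ^+ 2 <= 3 / 4 * s ^+ 2 by apply: ler_wpM2r.
  have h4 : s ^+ 2 <= (2 * sigma) ^+ 2 by rewrite exprMn; lra.
  by move: h4; rewrite ler_pXn2r// nnegrE; lra.
have s4 : s ^+ 4 <= 16 * sigma ^+ 4.
  have -> : 16 * sigma ^+ 4 = (2 * sigma) ^+ 4 by ring.
  by rewrite lerXn2r// nnegrE; lra.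
have s5 : s ^+ 5 <= 32 * sigma ^+ 5.
  have -> : 32 * sigma ^+ 5 = (2 * sigma) ^+ 5 by ring.
  by rewrite lerXn2r// nnegrE; lra.
have ms4 : m * s ^+ 4 <= m * (16 * sigma ^+ 4) by apply: ler_wpM2l.
have Ks5 : K * s ^+ 5 <= K * (32 * sigma ^+ 5) by apply: ler_wpM2l.
have K54 : K * sigma ^+ 5 <= K * sigma ^+ 4 by apply: ler_wpM2l.
have s2 : s ^+ 2 <= sigma ^+ 2 + A * sigma ^+ 4 by rewrite AE; lra.
have s4' : s ^+ 4 <= sigma ^+ 4 + (2 * A + A ^+ 2) * sigma ^+ 5.
  have : (s ^+ 2) ^+ 2 <= (sigma ^+ 2 + A * sigma ^+ 4) ^+ 2.
    by rewrite lerXn2r// nnegrE ?(le_trans _ s2).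
  have -> : (s ^+ 2) ^+ 2 = s ^+ 4 by ring.
  have -> : (sigma ^+ 2 + A * sigma ^+ 4) ^+ 2 =
    sigma ^+ 4 + 2 * A * sigma ^+ 6 + A ^+ 2 * sigma ^+ 8 by ring.
  have : A * sigma ^+ 6 <= A * sigma ^+ 5 by apply: ler_wpM2l.
  have : A ^+ 2 * sigma ^+ 8 <= A ^+ 2 * sigma ^+ 5.
    apply: ler_wpM2l; first exact: sqr_ge0.
    exact: le_trans (pw1 7%N) (le_trans (pw1 6%N) (pw1 5%N)).
  by lra.
have ms4' : m * s ^+ 4 <= m * (sigma ^+ 4 + (2 * A + A ^+ 2) * sigma ^+ 5).
  by apply: ler_wpM2l.
have Bs : B * sigma ^+ 5 <= 2 * M * sigma ^+ 5 by apply: ler_wpM2r.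
have s2' : s ^+ 2 <= sigma ^+ 2 + m * sigma ^+ 4 + 2 * M * sigma ^+ 5.
  apply: le_trans (_ : sigma ^+ 2 + m * sigma ^+ 4 + B * sigma ^+ 5 <= _); last by lra.
  by rewrite BE; lra.
have M0 : 0 <= M by lra.
have rp0 : 0 <= m / 2 * sigma ^+ 3 + M * sigma ^+ 4.
  by rewrite addr_ge0// mulr_ge0// ?divr_ge0.
(* The square of the target radius is sigma^2 + m sigma^4 + 2 M sigma^5 plus a square, so the bound
   just obtained suffices. *)
rewrite -addrA -(@ler_pXn2r _ 2)// ?nnegrE; [|lra..].
apply: le_trans s2' _.
have -> : (sigma + (m / 2 * sigma ^+ 3 + M * sigma ^+ 4)) ^+ 2 =
  sigma ^+ 2 + m * sigma ^+ 4 + 2 * M * sigma ^+ 5 +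
  (m / 2 * sigma ^+ 3 + M * sigma ^+ 4) ^+ 2 by field.
by rewrite lerDl sqr_ge0.
Qed.

(** By contradiction: a lower bound on s^4 is needed, and the negated conclusion supplies one. It
    gives s^2 >= sigma^2 - 32 K sigma^5, then s^4 >= sigma^4 - 64 K sigma^5 because s^4 >= 2 sigma^2
    s^2 - sigma^4. Compared with the square of the assumed bound on s, this would force M < 64 K m +
    32 K. *)
Lemma chord_radius_lower (R : realType) (m K M sigma s : R) :
  0 <= m -> 0 <= K -> 0 <= s -> 0 < sigma -> sigma <= 1 ->
  64 * K * m + 32 * K <= M -> m * sigma <= 1 ->
  (m / 2 + M) ^+ 2 * sigma <= M ->
  s <= sigma + m / 2 * sigma ^+ 3 - M * sigma ^+ 4 ->
  s ^+ 2 - m * s ^+ 4 + K * s ^+ 5 <= sigma ^+ 2.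
Proof.
move=> m0 K0 s0 sg0 sg1 MK msg Msg sr.
have M0 : 0 <= M by nra.
have pw n : 0 <= sigma ^+ n by apply: exprn_ge0; lra.
have pw1 n : sigma ^+ n.+1 <= sigma ^+ n by rewrite exprS ler_piMl.
have s_2sg : s <= 2 * sigma.
  have : 0 <= M * sigma ^+ 4 by rewrite mulr_ge0.
  have : m * sigma ^+ 3 <= sigma.
    have -> : m * sigma ^+ 3 = (m * sigma) * sigma ^+ 2 by ring.
    have := pw1 1%N; rewrite expr1 => h.
    by apply: le_trans h; rewrite ler_piMl.
  by lra.
have s5 : s ^+ 5 <= 32 * sigma ^+ 5.
  have -> : 32 * sigma ^+ 5 = (2 * sigma) ^+ 5 by ring.
  by rewrite lerXn2r// nnegrE; lra.
have Ks5 : K * s ^+ 5 <= K * (32 * sigma ^+ 5) by apply: ler_wpM2l.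
have ms40 : 0 <= m * s ^+ 4 by rewrite mulr_ge0// exprn_ge0.
rewrite leNgt; apply/negP => q.
have s2 : sigma ^+ 2 - 32 * K * sigma ^+ 5 <= s ^+ 2 by lra.
have s4 : sigma ^+ 4 - 64 * K * sigma ^+ 5 <= s ^+ 4.
  have : 2 * sigma ^+ 2 * s ^+ 2 - sigma ^+ 4 <= s ^+ 4.
    have := sqr_ge0 (s ^+ 2 - sigma ^+ 2).
    have -> : (s ^+ 2 - sigma ^+ 2) ^+ 2 =
      s ^+ 4 - 2 * sigma ^+ 2 * s ^+ 2 + sigma ^+ 4 by ring.
    by lra.
  have : sigma ^+ 2 * (sigma ^+ 2 - 32 * K * sigma ^+ 5) <= sigma ^+ 2 * s ^+ 2.
    by apply: ler_wpM2l.
  have -> : sigma ^+ 2 * (sigma ^+ 2 - 32 * K * sigma ^+ 5) =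
    sigma ^+ 4 - 32 * K * sigma ^+ 7 by ring.
  have : K * sigma ^+ 7 <= K * sigma ^+ 5.
    by apply: ler_wpM2l => //; exact: le_trans (pw1 6%N) (pw1 5%N).
  by lra.
have ms4 : m * (sigma ^+ 4 - 64 * K * sigma ^+ 5) <= m * s ^+ 4 by apply: ler_wpM2l.
have : s ^+ 2 <= sigma ^+ 2 + m * sigma ^+ 4 - M * sigma ^+ 5.
  apply: (@le_trans _ _ ((sigma + m / 2 * sigma ^+ 3 - M * sigma ^+ 4) ^+ 2)).
    by rewrite lerXn2r// nnegrE// (le_trans s0).
  have -> : (sigma + m / 2 * sigma ^+ 3 - M * sigma ^+ 4) ^+ 2 =
    sigma ^+ 2 + m * sigma ^+ 4 - 2 * M * sigma ^+ 5 +
    (m / 2 - M * sigma) ^+ 2 * sigma ^+ 6 by field.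
  (* Squaring the radius produces -2 M sigma^5; one half of it absorbs the remaining square, the
     other half is kept for the contradiction. *)
  suff : (m / 2 - M * sigma) ^+ 2 * sigma ^+ 6 <= M * sigma ^+ 5 by lra.
  have -> : (m / 2 - M * sigma) ^+ 2 * sigma ^+ 6 =
    (m / 2 - M * sigma) ^+ 2 * sigma * sigma ^+ 5 by ring.
  apply: ler_wpM2r => //; apply: le_trans Msg; apply: ler_wpM2r; first lra.
  have -> : (m / 2 - M * sigma) ^+ 2 = `|m / 2 - M * sigma| ^+ 2 by rewrite real_normK// num_real.
  rewrite lerXn2r// ?nnegrE; first lra.
  by rewrite ler_norml; apply/andP; nra.
have : (64 * K * m + 32 * K) * sigma ^+ 5 <= M * sigma ^+ 5 by apply: ler_wpM2r.
by lra.
Qed.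

Lemma chord_radius (R : realType) (m K r0 : R) : 0 <= m -> 0 <= K ->
  r0 <= 1 -> (m + K) * r0 <= 3 / 4 ->
  exists2 M : R, 1 <= M & forall sigma s : R, 0 <= s -> s <= r0 ->
    0 < sigma -> sigma <= 1 ->
    (s ^+ 2 - m * s ^+ 4 - K * s ^+ 5 <= sigma ^+ 2 ->
      s <= sigma + m / 2 * sigma ^+ 3 + M * sigma ^+ 4) /\
    (m * sigma <= 1 -> (m / 2 + M) ^+ 2 * sigma <= M ->
      s <= sigma + m / 2 * sigma ^+ 3 - M * sigma ^+ 4 ->
      s ^+ 2 - m * s ^+ 4 + K * s ^+ 5 <= sigma ^+ 2).
Proof.
move=> m0 K0 r01 mKr0.
have [A AE] : exists A, A = 16 * m + 32 * K by eexists.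
have [B BE] : exists B, B = m * (2 * A + A ^+ 2) + 32 * K by eexists.
have A0 : 0 <= A by lra.
have B0 : 0 <= B by rewrite BE addr_ge0 ?mulr_ge0// addr_ge0// ?mulr_ge0// exprn_ge0.
have Km0 : 0 <= K * m by rewrite mulr_ge0.
(* The first term serves the outer radius, the next two the inner one, and the 1 ensures 1 <= M. *)
exists (B + 64 * K * m + 32 * K + 1); first by lra.
move=> sigma s s0 sr0 sg0 sg1; split.
  by apply: (chord_radius_upper _ m K r0 A B) => //; lra.
by move=> ms Ms sr; apply: chord_radius_lower sr => //; lra.
Qed.

(** The factor of sigma gathers all the smallness requirements: 1 and m give sigma <= 1, m sigma <=
    1 and the bound of the inner radius by r0; m / 2 + M keeps both radii within sigma of sigma; its
    square gives the third conclusion, through r0 <= 1 <= M. *)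
Lemma chord_radius_bounds (R : realType) (m M sigma r0 : R) :
  0 <= m -> 1 <= M -> 0 < sigma -> r0 <= 1 ->
  (1 + m + (m / 2 + M) + (m / 2 + M) ^+ 2) * sigma <= r0 ->
  let rm := sigma + m / 2 * sigma ^+ 3 - M * sigma ^+ 4 in
  let rp := sigma + m / 2 * sigma ^+ 3 + M * sigma ^+ 4 in
  [/\ sigma <= 1, m * sigma <= 1, (m / 2 + M) ^+ 2 * sigma <= M &
   [/\ 0 <= rm, rm <= rp, rm <= r0 & rp <= 2 * sigma]].
Proof.
move=> m0 M1 sg0 r01; set V := m / 2 + M => sgd.
have s0 := ltW sg0.
have M0 : 0 <= M by lra.
have V0 : 0 <= V by rewrite addr_ge0// divr_ge0.
have ms0 : 0 <= m * sigma by rewrite mulr_ge0.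
have Vs0 : 0 <= V * sigma by rewrite mulr_ge0.
have VVs0 : 0 <= V ^+ 2 * sigma by rewrite mulr_ge0// exprn_ge0.
have MV : M * sigma <= V * sigma by apply: ler_wpM2r; rewrite // lerDr divr_ge0.
have VE : V * sigma = m / 2 * sigma + M * sigma by rewrite mulrDl.
clearbody V.
have sg1 : sigma <= 1 by lra.
have pw2 : sigma ^+ 2 <= sigma by rewrite expr2 ler_piMl.
have pw3 : sigma ^+ 3 <= sigma by rewrite exprS ler_piMr// exprn_ile1.
have msg3 : m * sigma ^+ 3 <= m * sigma by rewrite ler_wpM2l.
have msg2 : m * sigma ^+ 2 <= m * sigma by rewrite ler_wpM2l.
have Msg3 : M * sigma ^+ 3 <= M * sigma by rewrite ler_wpM2l.
have Msg40 : 0 <= M * sigma ^+ 4 by rewrite mulr_ge0// exprn_ge0.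
have Msg4 : M * sigma ^+ 4 <= sigma.
  have -> : M * sigma ^+ 4 = M * sigma ^+ 3 * sigma by ring.
  by rewrite ler_piMl//; lra.
have msg30 : 0 <= m * sigma ^+ 3 by rewrite mulr_ge0// exprn_ge0.
split; [lra|lra|lra|split; [lra|lra|lra|]].
have : (m / 2 * sigma ^+ 2 + M * sigma ^+ 3) * sigma <= sigma.
  by rewrite ler_piMl//; lra.
by lra.
Qed.

(** * Integrals over almost symmetric intervals *)

Section BoundedIntegrals.
Context d (T : measurableType d) (R : realType) (mu : {measure set T -> \bar R}).
Implicit Types (S : set T) (f : T -> R).

Lemma bounded_integrable S f (B : R) : measurable S -> (mu S < +oo)%E ->
  measurable_fun S f -> (forall t, S t -> `|f t| <= B) ->
  mu.-integrable S (EFin \o f).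
Proof.
move=> mS Sfin mf fB; apply: measurable_bounded_integrable => //.
by exists B; split; rewrite ?num_real// => x Bx y /fB /le_trans; apply; exact: ltW.
Qed.

Lemma le_norm_Rintegral_bounded S f (B : R) : measurable S -> (mu S < +oo)%E ->
  measurable_fun S f -> (forall t, S t -> `|f t| <= B) ->
  `|\int[mu]_(t in S) f t| <= B * fine (mu S).
Proof.
move=> mS Sfin mf fB; have fi := bounded_integrable _ _ _ mS Sfin mf fB.
apply: le_trans (le_normr_Rintegral mS fi) _.
rewrite -Rintegral_cst//; apply: le_Rintegral => //.
- exact: integrable_norm.
- apply: (bounded_integrable _ _ `|B|) => //.
Qed.

End BoundedIntegrals.

Section RealIntegrals.
Variable R : realType.
Local Notation mu := (@lebesgue_measure R).

Lemma Rintegral_quartic (r c2 c3 c4 : R) : 0 <= r ->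
  \int[mu]_(t in `[- r, r]) (c2 * t ^+ 2 + c3 * t ^+ 3 + c4 * t ^+ 4) =
  2 * c2 / 3 * r ^+ 3 + 2 * c4 / 5 * r ^+ 5.
Proof.
(* The fundamental theorem of calculus requires -r < r, so r = 0 is treated apart. *)
rewrite le_eqVlt => /predU1P[<-|r0].
  by rewrite oppr0 set_itv1 Rintegral_set1; ring.
pose F (t : R) := c2 / 3 * t ^+ 3 + c3 / 4 * t ^+ 4 + c4 / 5 * t ^+ 5.
have dF (t : R) : is_derive t 1 F (c2 * t ^+ 2 + c3 * t ^+ 3 + c4 * t ^+ 4).
  by apply: is_derive_eq; rewrite /GRing.scale/=; field.
have cF : continuous F.
  by move=> t; apply/differentiable_continuous/derivable1_diffP; have [] := dF t.
rewrite /Rintegral (@continuous_FTC2 _ _ F)//=.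
- by rewrite /F; field.
- by lra.
- apply: derivable_within_continuous => t _.
  exact: ex_derive.
- split.
  + by move=> t _; have [] := dF t.
  + by apply: cvg_at_right_filter; exact: cF.
  + by apply: cvg_at_left_filter; exact: cF.
- by move=> t _; rewrite derive1E; have [_ ->] := dF t.
Qed.

(** Only the two bounding intervals of [S] are used. Replacing f by the polynomial costs [E] times
    the measure of [S]; discarding the part of [S] outside the inner interval costs [P] times its
    measure, at most 2 (rp - rm). On the inner interval the integral is exact. *)
Lemma Rintegral_near_interval (S : set (measurableTypeR R)) (f : measurableTypeR R -> R) (c2 c3 c4 rm rp E P : R) :
  measurable S -> measurable_fun S f -> 0 <= rm -> rm <= rp ->
  `[- rm, rm] `<=` S -> S `<=` `[- rp, rp] ->
  (forall t, S t -> `|f t - (c2 * t ^+ 2 + c3 * t ^+ 3 + c4 * t ^+ 4)| <= E) ->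
  (forall t, S t -> `|c2 * t ^+ 2 + c3 * t ^+ 3 + c4 * t ^+ 4| <= P) ->
  `|\int[mu]_(t in S) f t - (2 * c2 / 3 * rm ^+ 3 + 2 * c4 / 5 * rm ^+ 5)|
    <= E * (2 * rp) + P * (2 * (rp - rm)).
Proof.
set p : R -> R := fun t => c2 * t ^+ 2 + c3 * t ^+ 3 + c4 * t ^+ 4.
move=> mS mf rm0 rmp imS Sip fE pP.
have mp (T : set (measurableTypeR R)) : measurable_fun T (p : measurableTypeR R -> R).
  apply: measurable_funTS; apply: continuous_measurable_fun => t.
  apply/differentiable_continuous/derivable1_diffP; exact: ex_derive.
have mu_itv r : 0 <= r -> mu `[- r, r] = (2 * r)%:E.
  rewrite lebesgue_measure_itv/= lte_fin => r0; case: ifPn => [_|].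
    by rewrite -EFinD; congr EFin; ring.
  by rewrite -leNgt => ?; congr EFin; lra.
have rp0 := le_trans rm0 rmp.
have muS : (mu S <= (2 * rp)%:E)%E by rewrite -mu_itv//; apply: le_measure; rewrite ?inE.
have Sfin : (mu S < +oo)%E by rewrite (le_lt_trans muS)// ltry.
have muS' : fine (mu S) <= 2 * rp by rewrite -lee_fin fineK// ge0_fin_numE.
have E0 : 0 <= E by rewrite (le_trans _ (fE 0 _))//; apply: imS; rewrite /= in_itv/=; lra.
have P0 : 0 <= P by rewrite (le_trans _ (pP 0 _))//; apply: imS; rewrite /= in_itv/=; lra.
have ip : mu.-integrable S (EFin \o p) by apply: bounded_integrable pP.
have ie : mu.-integrable S (EFin \o (fun t => f t - p t)).
  by apply: bounded_integrable fE => //; exact: measurable_funB.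
have mD : measurable (S `\` `[- rm, rm]) by exact: measurableD.
have SE : `[- rm, rm] `|` (S `\` `[- rm, rm]) = S by exact: setDUK.
have -> : \int[mu]_(t in S) f t =
    \int[mu]_(t in S) (f t - p t) + \int[mu]_(t in S) p t.
  by rewrite -RintegralD//; apply: eq_Rintegral => t _; rewrite subrK.
have -> : \int[mu]_(t in S) p t = 2 * c2 / 3 * rm ^+ 3 + 2 * c4 / 5 * rm ^+ 5
    + \int[mu]_(t in S `\` `[- rm, rm]) p t.
  rewrite -{1}SE Rintegral_setU ?SE//; first by rewrite Rintegral_quartic.
  by apply/disj_setPS => t [? []].
move: (2 * c2 / 3 * rm ^+ 3 + 2 * c4 / 5 * rm ^+ 5) => Q.
rewrite (addrC Q) addrA addrK (le_trans (ler_normD _ _))// lerD//.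
  apply: le_trans (le_norm_Rintegral_bounded _ _ _ mu _ _ _ mS Sfin _ fE) _.
    exact: measurable_funB.
  by rewrite ler_wpM2l.
have muD : mu S = (mu (S `\` `[(- rm)%R, rm]%classic) + (2 * rm)%:E)%E.
  have mI : measurable (`[- rm, rm] : set (measurableTypeR R)) by [].
  by rewrite (measureDI mu mS mI) (setIidr imS); congr (_ + _)%E; exact: mu_itv.
have Dfin : (mu (S `\` `[(- rm)%R, rm]%classic) < +oo)%E.
  by apply: le_lt_trans Sfin; apply: le_measure; rewrite ?inE//; exact: subDsetl.
apply: le_trans (le_norm_Rintegral_bounded _ _ _ mu _ _ P mD Dfin (mp _) _) _.
  by move=> t [/pP].
rewrite ler_wpM2l//; move: muS; rewrite muD.
have : mu (S `\` `[- rm, rm]) \is a fin_num by rewrite ge0_fin_numE.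
by move=> /fineK <-; rewrite -EFinD lee_fin; lra.
Qed.

End RealIntegrals.

Section RadialAsymptotics.
Variable R : realType.
Local Notation mu := (@lebesgue_measure R).

(** With rm = sigma + sigma^3 v and |v| <= V, both bounds follow from the binomial formula, whose
    coefficients appear in the constants. The term 3 sigma^5 v yields 3/2 m sigma^5 and -3 M
    sigma^6. *)
Lemma radius_power_expansion (m M V sigma : R) :
  0 <= M -> 0 <= sigma -> sigma <= 1 -> `|m / 2| + M <= V ->
  let rm := sigma + m / 2 * sigma ^+ 3 - M * sigma ^+ 4 in
  `|rm ^+ 3 - (sigma ^+ 3 + 3 / 2 * m * sigma ^+ 5)|
    <= (3 * V + 3 * V ^+ 2 + V ^+ 3) * sigma ^+ 6 /\
  `|rm ^+ 5 - sigma ^+ 5|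
    <= (5 * V + 10 * V ^+ 2 + 10 * V ^+ 3 + 5 * V ^+ 4 + V ^+ 5) * sigma ^+ 6.
Proof.
move=> M0 s0 s1 mMV rm; pose v := m / 2 - M * sigma.
have Ms : `|M * sigma| <= M by rewrite ger0_norm ?mulr_ge0// ler_piMr.
have vV : `|v| <= V by rewrite (le_trans (ler_normB _ _))//; lra.
have MV : M <= V by have := normr_ge0 (m / 2); lra.
have tm k j : - V ^+ j <= sigma ^+ k * v ^+ j <= V ^+ j.
  rewrite -ler_norml normrM !normrX (ger0_norm s0) -[leRHS]mul1r.
  by rewrite ler_pM ?exprn_ge0// ?exprn_ile1// lerXn2r// nnegrE (le_trans _ vV).
have s6 : 0 <= sigma ^+ 6 by exact: exprn_ge0.
split.
  have -> : rm ^+ 3 - (sigma ^+ 3 + 3 / 2 * m * sigma ^+ 5) =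
      (- 3 * M + 3 * (sigma ^+ 1 * v ^+ 2) + sigma ^+ 3 * v ^+ 3) * sigma ^+ 6.
    by rewrite /rm /v; field.
  rewrite normrM (ger0_norm s6) ler_wpM2r// ler_norml.
  by have := tm 1%N 2%N; have := tm 3%N 3%N; lra.
have -> : rm ^+ 5 - sigma ^+ 5 =
    (5 * (sigma ^+ 1 * v ^+ 1) + 10 * (sigma ^+ 3 * v ^+ 2)
     + 10 * (sigma ^+ 5 * v ^+ 3) + 5 * (sigma ^+ 7 * v ^+ 4)
     + sigma ^+ 9 * v ^+ 5) * sigma ^+ 6.
  by rewrite /rm /v; field.
rewrite normrM (ger0_norm s6) ler_wpM2r// ler_norml.
have := tm 1%N 1%N; have := tm 3%N 2%N; have := tm 5%N 3%N.
by have := tm 7%N 4%N; have := tm 9%N 5%N; lra.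
Qed.

(** Here [q] is the squared chord and [f] a product of two coordinates. The coefficient c2 m is 2 c2
    / 3 times the 3 / 2 m found in the expansion of the cube of the inner radius. *)
Lemma Rintegral_sublevel_asymptotics (q : R -> R) (f : measurableTypeR R -> R)
    (m K r0 c2 c3 c4 : R) :
  0 <= m -> 0 <= K -> 0 < r0 -> r0 <= 1 -> (m + K) * r0 <= 3 / 4 ->
  (forall t, `|t| <= r0 -> `|q t - (t ^+ 2 - m * t ^+ 4)| <= K * `|t| ^+ 5) ->
  (forall t, `|t| <= r0 ->
    `|f t - (c2 * t ^+ 2 + c3 * t ^+ 3 + c4 * t ^+ 4)| <= K * `|t| ^+ 5) ->
  exists eps L : R, [/\ 0 < eps, 0 <= L &
    forall (sigma : R) (S : set (measurableTypeR R)), 0 < sigma -> sigma <= eps ->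
    measurable S -> measurable_fun S f ->
    (forall t, S t <-> `|t| <= r0 /\ q t <= sigma ^+ 2) ->
    `|\int[mu]_(t in S) f t
      - (2 * c2 / 3 * sigma ^+ 3 + (c2 * m + 2 * c4 / 5) * sigma ^+ 5)|
    <= L * sigma ^+ 6].
Proof.
move=> m0 K0 r00 r01 mKr0 hq hf.
have [M M1 rad] := chord_radius _ m K r0 m0 K0 r01 mKr0.
have M0 : 0 <= M by lra.
have [V VE] : exists V : R, V = m / 2 + M by eexists.
have V0 : 0 <= V by rewrite VE addr_ge0// divr_ge0.
have V20 : 0 <= V ^+ 2 by rewrite exprn_ge0.
have [d dE] : exists d : R, d = 1 + m + V + V ^+ 2 by eexists.
have d0 : 0 < d by lra.
have [c cE] : exists c : R, c = `|c2| + `|c3| + `|c4| by eexists.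
have c0 : 0 <= c by rewrite cE !addr_ge0.
have [W3 W3E] : exists W3 : R, W3 = 3 * V + 3 * V ^+ 2 + V ^+ 3 by eexists.
have [W5 W5E] : exists W5 : R,
  W5 = 5 * V + 10 * V ^+ 2 + 10 * V ^+ 3 + 5 * V ^+ 4 + V ^+ 5 by eexists.
have W30 : 0 <= W3 by rewrite W3E !addr_ge0 ?mulr_ge0 ?exprn_ge0.
have W50 : 0 <= W5 by rewrite W5E !addr_ge0 ?mulr_ge0 ?exprn_ge0.
(* The four terms of the constant account for the error K (2 sigma)^5 on a set of measure at most 4
   sigma, for the polynomial, at most c (2 sigma)^2, on a remainder of measure at most 4 M sigma^4,
   and for the expansions of the third and fifth powers of the radius. *)
exists (r0 / d), (128 * K + 16 * M * c + 2 * `|c2| / 3 * W3 + 2 * `|c4| / 5 * W5).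
split; first by rewrite divr_gt0.
  by rewrite !addr_ge0 ?mulr_ge0 ?invr_ge0.
move=> sigma S sg0; rewrite ler_pdivlMr// dE => sgd mS mf SE.
have s0 := ltW sg0.
rewrite VE mulrC in sgd; have [sg1 msg VVsg] := chord_radius_bounds _ m M sigma r0 m0 M1 sg0 r01 sgd.
set rm := _ - _; set rp := _ + _ => -[rm0 rmp rmr0 rp2].
have t2 (t : R) : `|t| ^+ 2 = t ^+ 2 by rewrite real_normK// num_real.
have t4 (t : R) : `|t| ^+ 4 = t ^+ 4 by rewrite (exprM _ 2 2) t2 -exprM.
have imS : `[- rm, rm] `<=` S.
  move=> t /=; rewrite in_itv/= -ler_norml => trm; apply/SE.
  have tr0 : `|t| <= r0 by exact: le_trans rmr0.
  split => //; have /ler_normlP[_ qt] := hq t tr0.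
  have [_ /(_ msg VVsg trm)] := rad sigma `|t| (normr_ge0 _) tr0 sg0 sg1.
  by rewrite t2 t4; move: qt; clear; lra.
have Sip : S `<=` `[- rp, rp].
  move=> t /SE[tr0 qt] /=; rewrite in_itv/= -ler_norml.
  have /ler_normlP[qt' _] := hq t tr0.
  have [+ _] := rad sigma `|t| (normr_ge0 _) tr0 sg0 sg1; apply.
  by rewrite t2 t4; move: qt qt'; clear; lra.
have St t : S t -> [/\ `|t| <= r0, `|t| <= 1 & `|t| <= 2 * sigma].
  move=> St; have [tr0 _] := (SE t).1 St; split => //; first exact: le_trans r01.
  by have := Sip t St; rewrite /= in_itv/= -ler_norml => /le_trans; apply.
have fE t : S t -> `|f t - (c2 * t ^+ 2 + c3 * t ^+ 3 + c4 * t ^+ 4)|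
    <= K * (32 * sigma ^+ 5).
  move=> /St[tr0 _ t2s]; apply: le_trans (hf t tr0) _; apply: ler_wpM2l => //.
  have -> : 32 * sigma ^+ 5 = (2 * sigma) ^+ 5 by ring.
  by rewrite lerXn2r// nnegrE mulr_ge0.
have pP t : S t -> `|c2 * t ^+ 2 + c3 * t ^+ 3 + c4 * t ^+ 4| <= c * (4 * sigma ^+ 2).
  move=> /St[_ t1 t2s].
  have -> : 4 * sigma ^+ 2 = (2 * sigma) ^+ 2 by ring.
  have mon (e : R) k : `|e * t ^+ k.+2| <= `|e| * (2 * sigma) ^+ 2.
    rewrite normrM ler_wpM2l// normrX -addn2 exprD.
    apply: le_trans (_ : 1 * `|t| ^+ 2 <= _).
      by apply: ler_wpM2r; [exact: exprn_ge0|exact: exprn_ile1].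
    by rewrite mul1r lerXn2r// nnegrE mulr_ge0.
  rewrite cE 2!(mulrDl _ _ ((2 * sigma) ^+ 2)); apply: le_trans (ler_normD _ _) _; apply: lerD; last exact: (mon _ 2%N).
  by apply: le_trans (ler_normD _ _) _; apply: lerD; [exact: (mon _ 0%N)|exact: (mon _ 1%N)].
have := Rintegral_near_interval _ S f c2 c3 c4 rm rp _ _ mS mf rm0 rmp imS Sip fE pP.
have mMV : `|m / 2| + M <= V by rewrite VE ger0_norm// divr_ge0.
have [] := radius_power_expansion m M V sigma M0 s0 sg1 mMV.
rewrite -/rm -W3E -W5E.
set I := Rintegral _ _ _ => h3 h5 hI.
have -> : I - (2 * c2 / 3 * sigma ^+ 3 + (c2 * m + 2 * c4 / 5) * sigma ^+ 5) =
    (I - (2 * c2 / 3 * rm ^+ 3 + 2 * c4 / 5 * rm ^+ 5))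
    + (2 * c2 / 3 * (rm ^+ 3 - (sigma ^+ 3 + 3 / 2 * m * sigma ^+ 5))
       + 2 * c4 / 5 * (rm ^+ 5 - sigma ^+ 5)) by field.
apply: le_trans (ler_normD _ _) _.
have -> : (128 * K + 16 * M * c + 2 * `|c2| / 3 * W3 + 2 * `|c4| / 5 * W5) * sigma ^+ 6 =
    (128 * K + 16 * M * c) * sigma ^+ 6
    + (2 * `|c2| / 3 * (W3 * sigma ^+ 6) + 2 * `|c4| / 5 * (W5 * sigma ^+ 6)) by ring.
apply: lerD.
  apply: le_trans hI _.
  have -> : (128 * K + 16 * M * c) * sigma ^+ 6 =
    K * (32 * sigma ^+ 5) * (2 * (2 * sigma))
    + c * (4 * sigma ^+ 2) * (2 * (2 * M * sigma ^+ 4)) by ring.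
  apply: lerD.
    by apply: ler_wpM2l; [rewrite !mulr_ge0 ?exprn_ge0|move: rp2; clear; lra].
  by apply: ler_wpM2l; [rewrite !mulr_ge0 ?exprn_ge0|rewrite /rp /rm; clear; lra].
apply: le_trans (ler_normD _ _) _; apply: lerD.
  rewrite normrM; apply: ler_pM => //.
  by rewrite !normrM normfV !normr_nat.
rewrite normrM; apply: ler_pM => //.
by rewrite !normrM normfV !normr_nat.
Qed.

End RadialAsymptotics.

(** * Reduction to Lebesgue measure *)

Section Plane.
Variable R : realType.

(** The sigma-algebra is the product one, so [U] is written as a countable union of open boxes with
    rational centers and radii; [F] is empty for the boxes that leave [U]. *)
Lemma open_measurable_plane (U : set (R * R)) : open U -> measurable U.
Proof.
move=> oU; pose box (p q r : R) : set (R * R) :=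
  (`]p - r, p + r[ : set R) `*` (`]q - r, q + r[ : set R).
pose F (p q r : rat) : set (R * R) :=
  if `[< box (ratr p) (ratr q) (ratr r) `<=` U >]
  then box (ratr p) (ratr q) (ratr r) else set0.
suff -> : U = \bigcup_p \bigcup_q \bigcup_r F p q r.
  do 3 (apply: bigcupT_measurable_rat => ?); rewrite /F; case: ifP => // _.
  exact: measurableX.
apply/seteqP; split => [x Ux|x [p _ [q _ [r _]]]]; last first.
  by rewrite /F; case: ifP => // /asboolP; apply.
have /nbhs_ballP[e /= e0 eU] : nbhs x U by exact: open_nbhs_nbhs.
(* The box will contain [x], so its points are within 2 r < e of [x] in each coordinate. *)
have [r] := @rat_in_itvoo R 0 (e / 2) ltac:(lra).
rewrite in_itv/= => /andP[r0 re].
have [p] := @rat_in_itvoo R (x.1 - ratr r) x.1 ltac:(lra).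
rewrite in_itv/= => /andP[p1 p2].
have [q] := @rat_in_itvoo R (x.2 - ratr r) x.2 ltac:(lra).
rewrite in_itv/= => /andP[q1 q2].
exists p => //; exists q => //; exists r => //; rewrite /F.
have -> : `[< box (ratr p) (ratr q) (ratr r) `<=` U >].
  apply/asboolP => y []; rewrite /= !in_itv/= => /andP[y1 y2] /andP[y3 y4].
  by apply: eU; split; rewrite /ball/= ltr_norml; lra.
by split; rewrite /= in_itv/=; lra.
Qed.

Lemma compact_measurable_plane (K : set (R * R)) : compact K -> measurable K.
Proof.
move=> /(compact_closed (@norm_hausdorff _ _)) /closed_openC.
by move=> /open_measurable_plane/measurableC; rewrite setCK.
Qed.

Lemma enorm_le (v : R * R) (s : R) : 0 <= s ->
  (enorm v <= s) = (dot2 v v <= s ^+ 2).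
Proof.
move=> s0; rewrite /enorm -{1}(ger0_norm s0) -sqrtr_sqr ler_psqrt//.
- by rewrite nnegrE /dot2 -!expr2 addr_ge0// sqr_ge0.
- by rewrite nnegrE sqr_ge0.
Qed.

Lemma enorm_coord (v : R * R) (s : R) : 0 <= s -> enorm v <= s ->
  `|v.1| <= s /\ `|v.2| <= s.
Proof.
move=> s0; rewrite enorm_le// /dot2 => vs.
have le_sq (u : R) : u ^+ 2 <= s ^+ 2 -> `|u| <= s.
  by rewrite -(@ler_pXn2r _ 2 isT `|u|) ?nnegrE// real_normK// num_real.
have := sqr_ge0 v.1; have := sqr_ge0 v.2; rewrite !expr2 => ? ?.
by split; apply: le_sq; rewrite !expr2; move: vs; rewrite expr2; lra.
Qed.

Lemma measurable_disk (x : R * R) (s : R) : 0 <= s ->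
  measurable [set y | enorm (y - x) <= s].
Proof.
move=> s0; pose d (y : R * R) := (y.1 - x.1) * (y.1 - x.1) + (y.2 - x.2) * (y.2 - x.2).
have md : measurable_fun setT d.
  by apply: measurable_funD; apply: measurable_funM; apply: measurable_funB;
    try exact: measurable_fst; try exact: measurable_snd.
rewrite [X in measurable X](_ : _ = setT `&` d @^-1` `]-oo, s ^+ 2]); last first.
  by apply/seteqP; split=> y /=; rewrite in_itv/= enorm_le//; tauto.
exact: md.
Qed.

(** The disk lies in a compact square, whose trace on [C] is compact by properness, hence closed and
    measurable. *)
Lemma measurable_curve_disk (C : set (R * R)) (x : R * R) (s : R) : 0 <= s ->
  (forall K, compact K -> compact (C `&` K)) ->
  measurable (C `&` [set y | enorm (y - x) <= s]).
Proof.
move=> s0 hC.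
pose K : set (R * R) := (`[x.1 - s, x.1 + s] : set R) `*` (`[x.2 - s, x.2 + s] : set R).
have cK : compact K by apply: compact_setX; exact: segment_compact.
have -> : C `&` [set y | enorm (y - x) <= s] =
    (C `&` K) `&` [set y | enorm (y - x) <= s].
  apply/seteqP; split=> [y [Cy ys]|y [[Cy _] ys]]; split => //; split => //.
  have [] := enorm_coord _ _ s0 ys; rewrite !ler_norml /= => y1 y2.
  by split; rewrite /= in_itv/=; lra.
apply: measurableI; first by apply: compact_measurable_plane; exact: hC.
exact: measurable_disk.
Qed.

End Plane.

Section CurveIntegral.
Variables (R : realType) (C : set (R * R)) (alpha : {measure set (R * R) -> \bar R}).
Variables (a b : R) (gamma : R -> R * R) (x : R * R) (sigma : R) (U : set (R * R)).
Hypothesis properC : forall K, compact K -> compact (C `&` K).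
Hypothesis negC : alpha.-negligible (~` C).
Hypothesis arc : forall A : set (R * R), measurable A ->
  alpha (A `&` gamma @` `]a, b[) =
  (\int[lebesgue_measure]_(t in `]a, b[ `&` gamma @^-1` A) (speed gamma t)%:E)%E.
Hypothesis unit_speed : forall t, a < t < b -> speed gamma t = 1.
Hypothesis c1 : {in `]a, b[%R, continuous (fun t => (gamma t).1)}.
Hypothesis c2 : {in `]a, b[%R, continuous (fun t => (gamma t).2)}.
Hypothesis gammaU : gamma @` `]a, b[ = C `&` U.
Hypothesis sigma0 : 0 <= sigma.

Let D := [set y | enorm (y - x) <= sigma].
Hypothesis DU : D `<=` U.

Let S : set (measurableTypeR R) := [set t | a < t < b /\ D (gamma t)].
(* Outside ]a, b[, where [gamma] is arbitrary, the value is a point off the disk, so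
   that [gext] is measurable and the preimages of subsets of the disk ignore it. *)
Let gext (t : measurableTypeR R) : R * R :=
  if (t : R) \in `]a, b[%R then gamma t else (x.1 + sigma + 1, x.2).

Lemma measurable_gext : measurable_fun setT gext.
Proof.
have mitv : measurable_fun setT (fun t : measurableTypeR R => (t : R) \in `]a, b[%R).
  apply: (measurable_fun_bool true); rewrite setTI.
  rewrite [X in measurable X](_ : _ = `]a, b[%classic); last by apply/seteqP; split.
  exact: measurable_itv.
have oab : open (`]a, b[%classic : set R) by exact: interval_open.
have coord (c : R -> R) (c0 : R) : {in `]a, b[%R, continuous c} ->
    measurable_fun setT (fun t : measurableTypeR R =>
      if (t : R) \in `]a, b[%R then c t else c0).
  move=> cc; apply: measurable_fun_if => //.
  rewrite setTI [X in measurable_fun X](_ : _ = `]a, b[%classic); last by apply/seteqP; split.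
  apply: open_continuous_measurable_fun => // t; rewrite inE => tab.
  exact: cc.
rewrite (_ : gext = fun t : measurableTypeR R =>
  (if (t : R) \in `]a, b[%R then (gamma t).1 else x.1 + sigma + 1,
   if (t : R) \in `]a, b[%R then (gamma t).2 else x.2)); last first.
  by apply/funext => t; rewrite /gext; case: ifP => //; case: (gamma t).
by apply: measurable_fun_pair; exact: coord.
Qed.

Lemma gext_preimage (A : set (R * R)) : A `<=` D ->
  gext @^-1` A = `]a, b[ `&` gamma @^-1` A.
Proof.
move=> AD; apply/seteqP; split=> t; rewrite /= /gext; last by move=> [-> ].
case: ifP => // _ /AD; rewrite /D/= => /(enorm_coord _ _ _ sigma0)[+ _].
by rewrite /= ler_norml; lra.
Qed.

Lemma measurable_sublevel : measurable S.
Proof.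
rewrite (_ : S = gext @^-1` D).
  by rewrite -[X in measurable X]setTI; apply: measurable_gext => //; exact: measurable_disk.
by rewrite gext_preimage//; apply/seteqP; split=> t; rewrite /= in_itv.
Qed.

Lemma measurable_fun_curve (h : R * R -> R) : measurable_fun setT h ->
  measurable_fun S (fun t : measurableTypeR R => h (gamma t)).
Proof.
move=> mh; apply: (eq_measurable_fun (h \o gext)).
  by move=> t; rewrite inE => -[tab _]; rewrite /= /gext in_itv/= tab.
apply: measurable_funTS; exact: measurableT_comp measurable_gext.
Qed.

(** On the disk, [alpha] is the image of Lebesgue measure. The part of [A] off [C] is negligible;
    the rest lies in C [&] U, that is, on the parametrized piece, where the arc length element is
    dt. *)
Lemma alpha_disk (A : set (R * R)) : measurable A -> A `<=` D ->
  alpha A = lebesgue_measure (gext @^-1` A).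
Proof.
move=> mA AD; have mCD := measurable_curve_disk _ C x sigma sigma0 properC.
have mA' : measurable (gext @^-1` A).
  by rewrite -[X in measurable X]setTI; apply: measurable_gext.
have -> : alpha A = (alpha (A `\` (C `&` D)) + alpha (A `&` (C `&` D)))%E.
  exact: measureDI.
have -> : alpha (A `\` (C `&` D)) = 0%E.
  apply: measure_negligible; first exact: measurableD.
  apply: negligibleS negC => y [Ay nCD] Cy; apply: nCD; split => //; exact: AD.
rewrite add0e (_ : A `&` (C `&` D) = A `&` gamma @` `]a, b[); last first.
  rewrite gammaU; apply/seteqP; split=> [y [Ay [Cy Dy]]|y [Ay [Cy Uy]]].
    by split => //; split => //; exact: DU.
  by split => //; split => //; exact: AD.
rewrite arc// -gext_preimage//.
rewrite (eq_integral (cst 1%E)) ?integral_cst ?mul1e// => t.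
rewrite inE gext_preimage// => -[tab _]; by rewrite unit_speed.
Qed.

Lemma truncated_integral_curve (h : R * R -> R) (B : R) :
  measurable_fun setT h -> (forall y, D y -> `|h y| <= B) ->
  \int[alpha]_(y in setT) (h y * truncation_kernel x y sigma) =
  (pi * sigma ^+ 2)^-1 * \int[lebesgue_measure]_(t in S) h (gamma t).
Proof.
move=> mh hB; set c := (pi * _)^-1.
have mD : measurable D by exact: measurable_disk.
have SE : S = gext @^-1` D.
  by rewrite gext_preimage//; apply/seteqP; split=> t; rewrite /= in_itv.
have mS : measurable S by exact: measurable_sublevel.
have Sfin : (lebesgue_measure S < +oo)%E.
  apply: (@le_lt_trans _ _ (lebesgue_measure (`]a, b[%classic : set (measurableTypeR R)))).
    by apply: le_measure; rewrite ?inE// => t [tab _]; rewrite /= in_itv.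
  by rewrite lebesgue_measure_itv/=; case: ifP => _; rewrite ?ltry// -EFinB ltry.
have ih : lebesgue_measure.-integrable S (EFin \o (fun t : measurableTypeR R => h (gamma t))).
  apply: (bounded_integrable _ _ _ _ _ _ B) => //; first exact: measurable_fun_curve.
  by move=> t [_ /hB].
rewrite -RintegralZl//.
transitivity (\int[alpha]_(y in D) (c * h y)).
  rewrite [RHS]Rintegral_mkcond; apply: eq_Rintegral => y _.
  rewrite patchE /truncation_kernel -/c; case: ifPn => [yD|yD].
    by rewrite mem_set// mulrC.
  by rewrite memNset ?mulr0//; exact/negP.
rewrite /Rintegral; congr fine.
(* The two measures need only agree on the measurable subsets of [D], over which the integral is
   taken. *)
rewrite (@eq_measure_integral _ _ _ D (pushforward lebesgue_measure gext));
  [exact: measurable_gext|move=> mgext|by move=> ? A mA AD; exact: alpha_disk].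
have gextS (t : measurableTypeR R) : t \in S -> (c * h (gext t))%:E = (c * h (gamma t))%:E.
  by rewrite inE /gext => -[tab _]; rewrite in_itv/= tab.
have mch : measurable_fun setT (fun y => (c * h y)%:E).
  by apply/measurable_EFinP; apply: measurable_funM.
rewrite (integral_pushforward mgext mch)//.
  by rewrite -SE; apply: eq_integral => t tS; exact: gextS.
rewrite -SE; apply: (eq_integrable mS (fun t => (c%:E * (h (gamma t))%:E)%E)).
  by move=> t tS; rewrite -EFinM; exact: (esym (gextS _ tS)).
exact: integrableZl.
Qed.

End CurveIntegral.

(** * Entries of the covariance tensor *)

(** With pu and pv the cubic polynomials, u v - pu pv = (u - pu) v + pu (v - pv), where each product
    pairs an O(t^4) with an O(t). The terms of degree 5 and 6 of pu pv go into the constant, the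
    latter thanks to |t| <= 1. *)
Lemma product_expansion (R : realType) (u v u1 u2 u3 v1 v2 v3 K t : R) :
  0 <= K -> `|t| <= 1 ->
  `|u - (u1 * t + u2 * t ^+ 2 + u3 * t ^+ 3)| <= K * `|t| ^+ 4 ->
  `|v - (v1 * t + v2 * t ^+ 2 + v3 * t ^+ 3)| <= K * `|t| ^+ 4 ->
  `|u * v - (u1 * v1 * t ^+ 2 + (u1 * v2 + u2 * v1) * t ^+ 3
             + (u1 * v3 + u2 * v2 + u3 * v1) * t ^+ 4)|
  <= (K * (`|v1| + `|v2| + `|v3| + K) + (`|u1| + `|u2| + `|u3|) * K
      + (`|u2| * `|v3| + `|u3| * `|v2| + `|u3| * `|v3|)) * `|t| ^+ 5.
Proof.
move=> K0 t1; set pu := u1 * t + _ + _; set pv := v1 * t + _ + _ => uK vK.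
have pw n : `|t| ^+ n.+1 <= `|t|.
  by rewrite exprS ler_piMr// exprn_ile1.
have cubic (a1 a2 a3 : R) :
    `|a1 * t + a2 * t ^+ 2 + a3 * t ^+ 3| <= (`|a1| + `|a2| + `|a3|) * `|t|.
  rewrite 2!(mulrDl _ _ `|t|).
  apply: le_trans (ler_normD _ _) _; apply: lerD.
    apply: le_trans (ler_normD _ _) _; apply: lerD; rewrite normrM//.
    by rewrite normrX ler_wpM2l//; exact: (pw 1%N).
  by rewrite normrM normrX ler_wpM2l//; exact: (pw 2%N).
have vle : `|v| <= (`|v1| + `|v2| + `|v3| + K) * `|t|.
  rewrite -[v](subrK pv) addrC (mulrDl _ K).
  apply: le_trans (ler_normD _ _) _; apply: lerD; first exact: cubic.
  by apply: le_trans vK _; rewrite ler_wpM2l//; exact: (pw 3%N).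
have -> : u * v - (u1 * v1 * t ^+ 2 + (u1 * v2 + u2 * v1) * t ^+ 3
             + (u1 * v3 + u2 * v2 + u3 * v1) * t ^+ 4) =
    (u - pu) * v + pu * (v - pv)
    + (u2 * v3 * t ^+ 5 + u3 * v2 * t ^+ 5 + u3 * v3 * (t ^+ 5 * t)).
  by rewrite /pu /pv; ring.
have t5 : `|t| ^+ 5 = `|t| ^+ 4 * `|t| by rewrite exprSr.
rewrite !(mulrDl _ _ (`|t| ^+ 5)).
apply: le_trans (ler_normD _ _) _; apply: lerD.
  apply: le_trans (ler_normD _ _) _; apply: lerD.
    rewrite normrM t5 mulrACA.
    exact: ler_pM.
  rewrite normrM.
  rewrite (_ : _ * `|t| ^+ 5 = (`|u1| + `|u2| + `|u3|) * `|t| * (K * `|t| ^+ 4)).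
    by apply: ler_pM => //; exact: cubic.
  by rewrite t5; ring.
apply: le_trans (ler_normD _ _) _; apply: lerD.
  by apply: le_trans (ler_normD _ _) _; apply: lerD; rewrite 2!normrM normrX.
rewrite 3!normrM normrX ler_wpM2l ?mulr_ge0//.
by rewrite ler_piMr// exprn_ge0.
Qed.

Section LocalExpansion.
Variables (R : realType) (a b : R) (gamma : R -> R * R).
Hypothesis ab0 : a < 0 < b.
Hypothesis gamma_smooth : smooth_on a b gamma.
Hypothesis gamma_unit : forall t, a < t < b -> speed gamma t = 1.

Local Notation T := (unit_tangent gamma 0).
Local Notation N := (unit_normal gamma 0).
Local Notation kappa := (curvature gamma 0).
Local Notation kappa_s := (curvature_s gamma 0).

(** The third derivative of [gamma] at 0, by the Frenet formulas. *)
Let third : R * R := - kappa ^+ 2 *: T + kappa_s *: N.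

Lemma coord_expansion (p : R * R -> R) : (forall v w, p (v - w) = p v - p w) ->
  (forall k v, p (k *: v) = k * p v) ->
  (forall n (t : R), a < t < b ->
    is_derive t 1 (fun s => p (gamma^`(n)%classic s)) (p (gamma^`(n.+1)%classic t))) ->
  exists r K : R, [/\ 0 < r, 0 <= K, forall t, `|t| <= r -> a < t < b &
    forall t, `|t| <= r ->
      `|p (gamma t - gamma 0)
        - (p T * t + kappa * p N / 2 * t ^+ 2 + p third / 6 * t ^+ 3)|
      <= K * `|t| ^+ 4].
Proof.
move=> pB pZ dp.
have [r [K [r0 K0 rab rK]]] := taylor_order3 _ _ a b ab0 dp.
exists r, K; split => // t /rK.
have dG1 n (s : R) (sab : a < s < b) := (is_derive_fst_snd _ _ _ (gamma_smooth n s sab)).1.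
have dG2 n (s : R) (sab : a < s < b) := (is_derive_fst_snd _ _ _ (gamma_smooth n s sab)).2.
have unit1 (s : R) (sab : a < s < b) := dot2_unit_speed _ _ _ (gamma_unit s sab).
have -> : gamma^`(2)%classic 0 = kappa *: N.
  exact: (second_derivative_normal _ a b (fun n => gamma^`(n)%classic) dG1 dG2 unit1 0 ab0).
have -> : gamma^`(3)%classic 0 = third.
  exact: (third_derivative_frame _ a b (fun n => gamma^`(n)%classic) dG1 dG2 unit1 0 ab0).
rewrite pZ pB; apply: le_trans; rewrite le_eqVlt; apply/orP; left; apply/eqP; congr (`| _ |).
by rewrite derive1n0 derive1n1; ring.
Qed.

End LocalExpansion.

Definition coord2 (R : realType) (i : 'I_2) (v : R * R) : R :=
  if i == 0 then v.1 else v.2.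

Lemma ord2_cases (i : 'I_2) : i = 0 \/ i = 1.
Proof. by case: i => [[|[|//]]] lti; [left|right]; apply/val_inj. Qed.

Section Covariance.
Variables (R : realType) (C : set (R * R)).
Variables (alpha : {measure set (R * R) -> \bar R}) (x : R * R).
Hypothesis hC : smooth_plane_curve C.
Hypothesis halpha : arc_length_measure C alpha.
Variables (a b : R) (gamma : R -> R * R).
Hypothesis hgamma : arc_length_parametrization C a b gamma.
Hypothesis ab0 : a < 0 < b.
Hypothesis gamma0 : gamma 0 = x.

Local Notation T := (unit_tangent gamma 0).
Local Notation N := (unit_normal gamma 0).
Local Notation kappa := (curvature gamma 0).
Local Notation kappa_s := (curvature_s gamma 0).
Local Notation m := (kappa ^+ 2 / 12).
Let third : R * R := - kappa ^+ 2 *: T + kappa_s *: N.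
(* The coefficient of t^4 in the product of the coordinates i and j of gamma - x. *)
Let quartic (i j : 'I_2) : R :=
  coord2 R i T * coord2 R j third / 6 + kappa ^+ 2 / 4 * coord2 R i N * coord2 R j N
  + coord2 R i third * coord2 R j T / 6.

Lemma dot2_tangent : dot2 T T = 1.
Proof. by apply: dot2_unit_speed; case: hgamma => _; apply. Qed.

(** Openness of U keeps the disk away from the rest of [C]. Continuity at [x] of the inverse g, with
    g(x) = 0, keeps the parameters small: an immersion alone could return near [x] at a parameter
    far from 0. *)
Lemma small_disks (r0 : R) : 0 < r0 -> exists2 eps : R, 0 < eps &
  forall sigma : R, 0 < sigma -> sigma <= eps ->
  exists U, [/\ gamma @` `]a, b[ = C `&` U,
    [set y | enorm (y - x) <= sigma] `<=` U &
    forall t, a < t < b -> enorm (gamma t - x) <= sigma -> `|t| <= r0].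
Proof.
move=> r00; have [[_ _ [U [g [oU gU gK cg]]]] _] := hgamma.
have CUx : (C `&` U) x.
  by rewrite -gU -gamma0; exists 0; rewrite //= in_itv.
have g0 : g x = 0 by rewrite -gamma0 gK.
have /nbhs_ballP[e /= e0 eU] : nbhs x U.
  by apply: open_nbhs_nbhs; split => //; have [] := CUx.
have : \forall y \near x, (C `&` U) y -> `|g y| < r0.
  have /subspace_continuousP/(_ x CUx)/cvgrPdist_lt/(_ r0 r00) := cg.
  rewrite near_withinE; apply: filterS => y gy /gy.
  by rewrite /from_subspace g0 sub0r normrN.
move=> /nbhs_ballP[d /= d0 dg].
have inball (s c : R) y : 0 < s -> s < c -> enorm (y - x) <= s -> ball x c y.
  move=> s0 sc ys; have [y1 y2] := enorm_coord _ _ _ (ltW s0) ys.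
  by split; rewrite /ball/= distrC; apply: le_lt_trans sc.
exists (Num.min (e / 2) (d / 2)); first by rewrite lt_min !divr_gt0.
move=> sigma s0; rewrite le_min => /andP[se sd].
exists U; split => //.
  move=> y /= ys; apply: eU; apply: inball ys => //; lra.
move=> t tab ts; rewrite -(gK t tab).
apply/ltW/dg; first by apply: inball ts => //; lra.
by rewrite -[_ /\ _]/((C `&` U) (gamma t)) -gU; exists t; rewrite //= in_itv.
Qed.

Lemma coord2_expansion (i : 'I_2) : exists r K : R,
  [/\ 0 < r, 0 <= K, forall t, `|t| <= r -> a < t < b &
    forall t, `|t| <= r ->
      `|coord2 R i (gamma t - x)
        - (coord2 R i T * t + kappa * coord2 R i N / 2 * t ^+ 2
           + coord2 R i third / 6 * t ^+ 3)|
      <= K * `|t| ^+ 4].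
Proof.
have [[gsm _ _] gunit] := hgamma; rewrite -gamma0.
apply: (coord_expansion _ _ _ _ ab0 gsm gunit); rewrite /coord2; case: (i == 0) => //.
- by move=> n t tab; have [] := is_derive_fst_snd _ _ _ (gsm n t tab).
- by move=> n t tab; have [] := is_derive_fst_snd _ _ _ (gsm n t tab).
Qed.

Lemma coord2_product_expansion : exists r K : R,
  [/\ 0 < r, r <= 1, 0 <= K, (m + 2 * K) * r <= 3 / 4 &
   (forall t, `|t| <= r -> a < t < b) /\
   (forall i j t, `|t| <= r ->
     `|coord2 R i (gamma t - x) * coord2 R j (gamma t - x)
       - (coord2 R i T * coord2 R j T * t ^+ 2
          + (coord2 R i T * (kappa * coord2 R j N / 2)
             + kappa * coord2 R i N / 2 * coord2 R j T) * t ^+ 3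
          + quartic i j * t ^+ 4)| <= K * `|t| ^+ 5)].
Proof.
have [r1 [K1 [r10 K10 r1ab h1]]] := coord2_expansion 0.
have [r2 [K2 [r20 K20 r2ab h2]]] := coord2_expansion 1.
pose K := K1 + K2; have K0 : 0 <= K by rewrite addr_ge0.
have t4 (t : R) : 0 <= `|t| ^+ 4 by exact: exprn_ge0.
have h i t : `|t| <= r1 -> `|t| <= r2 -> `|coord2 R i (gamma t - x)
        - (coord2 R i T * t + kappa * coord2 R i N / 2 * t ^+ 2
           + coord2 R i third / 6 * t ^+ 3)| <= K * `|t| ^+ 4.
  move=> tr1 tr2; have [->|->] := ord2_cases i.
    by apply: le_trans (h1 t tr1) _; apply: ler_wpM2r => //; rewrite lerDl.
  by apply: le_trans (h2 t tr2) _; apply: ler_wpM2r => //; rewrite lerDr.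
pose B (i j : 'I_2) := (K * (`|coord2 R j T| + `|kappa * coord2 R j N / 2| + `|coord2 R j third / 6| + K)
  + (`|coord2 R i T| + `|kappa * coord2 R i N / 2| + `|coord2 R i third / 6|) * K
      + (`|kappa * coord2 R i N / 2| * `|coord2 R j third / 6|
         + `|coord2 R i third / 6| * `|kappa * coord2 R j N / 2|
         + `|coord2 R i third / 6| * `|coord2 R j third / 6|)).
have B0 i j : 0 <= B i j by rewrite !addr_ge0 ?mulr_ge0 ?addr_ge0.
pose L := \sum_i \sum_j B i j.
have BL i j : B i j <= L.
  rewrite /L (bigD1 i)//= (bigD1 j)//= -addrA lerDl addr_ge0 ?sumr_ge0// => k _.
  by rewrite sumr_ge0.
have L0 : 0 <= L by exact: le_trans (B0 0 0) (BL 0 0).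
have m0 : 0 <= m by rewrite divr_ge0// sqr_ge0.
(* The last quotient secures both r <= 1 and the smallness condition (m + 2 L) r <= 3/4; the factor
   2 anticipates the squared chord, a sum of two products. *)
pose r := Num.min (Num.min r1 r2) (3 / 4 / (1 + m + 2 * L)).
have d0 : 0 < 1 + m + 2 * L by lra.
have r0 : 0 < r by rewrite !lt_min r10 r20 divr_gt0.
have rm : r * (1 + m + 2 * L) <= 3 / 4 by rewrite -ler_pdivlMr// /r ge_min lexx orbT.
have rm0 : 0 <= r * m by rewrite mulr_ge0// ltW.
have rL0 : 0 <= r * L by rewrite mulr_ge0// ltW.
have r11 : r <= 1 by lra.
have rr1 : r <= r1 by rewrite /r !ge_min lexx.
have rr2 : r <= r2 by rewrite /r !ge_min lexx orbT.
exists r, L; split => //; first by lra.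
split=> [t tr|i j t tr]; first exact/r1ab/(le_trans tr).
have tr1 := le_trans tr rr1; have tr2 := le_trans tr rr2.
have := product_expansion _ _ _ _ _ _ _ _ _ _ _ K0 (le_trans tr r11)
  (h i t tr1 tr2) (h j t tr1 tr2).
rewrite -/(B i j) => hij.
apply: (@le_trans _ _ (B i j * `|t| ^+ 5)); last by rewrite ler_wpM2r// exprn_ge0.
apply: le_trans hij; rewrite le_eqVlt; apply/orP; left; apply/eqP; congr (`| _ - (_ + _ * _)|).
by rewrite /quartic; field.
Qed.

(** Summing over i, the coefficient of t^2 is |T|^2 = 1, that of t^3 is a multiple of T.N = 0, and
    that of t^4 is T.third / 3 + kappa^2 |N|^2 / 4 = -kappa^2 / 12. *)
Lemma squared_chord_expansion (r K : R) :
  (forall i t, `|t| <= r ->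
     `|coord2 R i (gamma t - x) * coord2 R i (gamma t - x)
       - (coord2 R i T * coord2 R i T * t ^+ 2
          + (coord2 R i T * (kappa * coord2 R i N / 2)
             + kappa * coord2 R i N / 2 * coord2 R i T) * t ^+ 3
          + quartic i i * t ^+ 4)| <= K * `|t| ^+ 5) ->
  forall t, `|t| <= r ->
    `|dot2 (gamma t - x) (gamma t - x) - (t ^+ 2 - m * t ^+ 4)| <= 2 * K * `|t| ^+ 5.
Proof.
move=> h t tr; have := dot2_tangent; move: (h 0 t tr) (h 1 t tr).
rewrite /quartic /third /unit_normal /rot90 /coord2 /dot2 /=.
move: (gamma t - x) T => [w1 w2] [T1 T2] /=; rewrite /GRing.scale/= => h1 h2 TT.
have -> : 2 * K * `|t| ^+ 5 = K * `|t| ^+ 5 + K * `|t| ^+ 5 by ring.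
set e1 := (X in `|X| <= _) in h1; set e2 := (X in `|X| <= _) in h2.
rewrite (_ : _ - _ = e1 + e2); first exact: le_trans (ler_normD _ _) (lerD h1 h2).
have -> : t ^+ 2 - kappa ^+ 2 / 12 * t ^+ 4 =
    (T1 * T1 + T2 * T2) * (t ^+ 2 - kappa ^+ 2 / 12 * t ^+ 4) by rewrite TT mul1r.
by rewrite /e1 /e2; field.
Qed.

Lemma covariance_entry_asymptotics (i j : 'I_2) : exists eps L : R,
  [/\ 0 < eps, 0 <= L & forall sigma : R, 0 < sigma -> sigma <= eps ->
  `|covariance_tensor alpha x sigma i j
    - (2 * (coord2 R i T * coord2 R j T) / 3 * sigma
       + (coord2 R i T * coord2 R j T * m + 2 * quartic i j / 5) * sigma ^+ 3) / pi|
  <= L * sigma ^+ 4].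
Proof.
have [r [K [r0 r1 K0 mKr [rab expand]]]] := coord2_product_expansion.
have K20 : 0 <= 2 * K by rewrite mulr_ge0.
have m0 : 0 <= m by rewrite divr_ge0// sqr_ge0.
have hq := squared_chord_expansion r K (fun i => expand i i).
(* The constant is doubled to match that of [hq], as a single one is used for the chord and for the
   integrand. *)
have hf t : `|t| <= r -> `|coord2 R i (gamma t - x) * coord2 R j (gamma t - x)
       - (coord2 R i T * coord2 R j T * t ^+ 2
          + (coord2 R i T * (kappa * coord2 R j N / 2)
             + kappa * coord2 R i N / 2 * coord2 R j T) * t ^+ 3
          + quartic i j * t ^+ 4)| <= 2 * K * `|t| ^+ 5.
  move=> tr; apply: le_trans (expand i j t tr) _.
  by apply: ler_wpM2r; [exact: exprn_ge0|lra].
have [e1 e10 loc] := small_disks r r0.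
have [e2 [L [e20 L0 asym]]] := Rintegral_sublevel_asymptotics _
  (fun t => dot2 (gamma t - x) (gamma t - x))
  (fun t => coord2 R i (gamma t - x) * coord2 R j (gamma t - x))
  _ _ _ _ _ _ m0 K20 r0 r1 mKr hq hf.
have pi0 : 0 < pi :> R by exact: pi_gt0.
exists (Num.min e1 e2), (L / pi); split; first by rewrite lt_min e10.
  by rewrite divr_ge0// ltW.
move=> sigma s0; rewrite le_min => /andP[se1 se2].
have [U [gU DU loct]] := loc sigma s0 se1.
have sg0 := ltW s0.
have [lp unit_sp] := hgamma.
have gsm : smooth_on a b gamma by have [] := lp.
have [_ hprop] := hC; have [negC harc] := halpha.
have cont (p : R * R -> R) : (forall t : R, a < t < b ->
    is_derive t 1 (fun s => p (gamma s)) (p (gamma^`() t))) ->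
    {in `]a, b[%R, continuous (fun t => p (gamma t))}.
  move=> dp t; rewrite in_itv/= => /dp[+ _].
  by move=> /derivable1_diffP/differentiable_continuous.
have c1 := cont fst (fun t tab => (is_derive_fst_snd _ _ _ (gsm 0%N t tab)).1).
have c2 := cont snd (fun t tab => (is_derive_fst_snd _ _ _ (gsm 0%N t tab)).2).
pose S : set (measurableTypeR R) :=
  [set t | a < t < b /\ [set y | enorm (y - x) <= sigma] (gamma t)].
have mS : measurable S by exact: (measurable_sublevel _ a b gamma x sigma c1 c2 sg0).
pose h (y : R * R) := coord2 R i (y - x) * coord2 R j (y - x).
have mcoord k : measurable_fun setT (fun y : R * R => coord2 R k (y - x)).
  rewrite /coord2; case: (k == 0); apply: (measurable_funB _ (measurable_cst _)).
    exact: measurable_fst.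
  exact: measurable_snd.
have mh : measurable_fun setT h by apply: measurable_funM; exact: mcoord.
have mfS := measurable_fun_curve _ a b gamma x sigma c1 c2 h mh.
have hB y : [set y | enorm (y - x) <= sigma] y -> `|h y| <= sigma * sigma.
  move=> /= ys; have [y1 y2] := enorm_coord _ _ _ sg0 ys.
  by rewrite normrM ler_pM// /coord2; case: ifP.
have SE t : S t <-> `|t| <= r /\ dot2 (gamma t - x) (gamma t - x) <= sigma ^+ 2.
  split=> [[tab /= ts]|[tr qs]].
    by split; [exact: loct ts|rewrite -enorm_le].
  by split; [exact: rab|rewrite /= enorm_le].
have -> : covariance_tensor alpha x sigma i j =
    \int[alpha]_(y in setT) (h y * truncation_kernel x y sigma).
  rewrite /covariance_tensor mxE; apply: eq_Rintegral => y _.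
  by rewrite mxE big_ord1 !mxE.
rewrite (truncated_integral_curve _ C alpha a b gamma x sigma U hprop negC
  (harc a b gamma lp) unit_sp c1 c2 gU sg0 DU h (sigma * sigma) mh hB).
have := asym sigma S s0 se2 mS mfS SE.
rewrite -/S /h; set I := Rintegral _ _ _ => hI.
have sn0 : sigma != 0 by rewrite gt_eqF.
have pn0 : pi != 0 :> R by rewrite gt_eqF.
have scaled (p A B : R) : p != 0 ->
    (p * sigma ^+ 2)^-1 * I - (A * sigma + B * sigma ^+ 3) / p =
    (I - (A * sigma ^+ 3 + B * sigma ^+ 5)) * (p * sigma ^+ 2)^-1.
  by move=> p0; field; rewrite sn0.
have rescaled (p : R) : p != 0 ->
    L / p * sigma ^+ 4 = L * sigma ^+ 6 * (p * sigma ^+ 2)^-1.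
  by move=> p0; field; rewrite sn0.
rewrite scaled// rescaled//.
have ps0 : 0 <= (pi * sigma ^+ 2)^-1 by rewrite invr_ge0 mulr_ge0 ?exprn_ge0// ltW.
by rewrite normrM (ger0_norm ps0) ler_wpM2r.
Qed.

(** Contraction with [u] and [v] is a finite sum whose coefficients do not depend on sigma, so the
    entrywise errors O(sigma^4) add up to one of the same order. *)
Lemma in_frame_asymptotics (u v : R * R) : exists eps L : R,
  [/\ 0 < eps, 0 <= L & forall sigma : R, 0 < sigma -> sigma <= eps ->
  `|\sum_i \sum_j coord2 R i u * covariance_tensor alpha x sigma i j * coord2 R j v
    - \sum_i \sum_j coord2 R i u *
       ((2 * (coord2 R i T * coord2 R j T) / 3 * sigma
       + (coord2 R i T * coord2 R j T * m + 2 * quartic i j / 5) * sigma ^+ 3) / pi)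
       * coord2 R j v|
  <= L * sigma ^+ 4].
Proof.
have /choice[eL eLP] : forall ij : 'I_2 * 'I_2, exists eL : R * R,
    [/\ 0 < eL.1, 0 <= eL.2 & forall sigma : R, 0 < sigma -> sigma <= eL.1 ->
    `|covariance_tensor alpha x sigma ij.1 ij.2
      - (2 * (coord2 R ij.1 T * coord2 R ij.2 T) / 3 * sigma
       + (coord2 R ij.1 T * coord2 R ij.2 T * m + 2 * quartic ij.1 ij.2 / 5) * sigma ^+ 3) / pi|
    <= eL.2 * sigma ^+ 4].
  move=> [i j]; have [e [L eLP]] := covariance_entry_asymptotics i j.
  by exists (e, L).
pose eps := Num.min (Num.min (eL (0, 0)).1 (eL (0, 1)).1)
                    (Num.min (eL (1, 0)).1 (eL (1, 1)).1).
exists eps, (\sum_i \sum_j `|coord2 R i u| * (eL (i, j)).2 * `|coord2 R j v|); split.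
- by rewrite !lt_min; apply/andP; split; apply/andP; split;
    match goal with |- is_true (0 < (eL ?ij).1) => by case: (eLP ij) end.
- apply: sumr_ge0 => i _; apply: sumr_ge0 => j _.
  by case: (eLP (i, j)) => _ L0 _; rewrite !mulr_ge0.
move=> sigma s0; rewrite /eps !le_min => /andP[/andP[h00 h01] /andP[h10 h11]].
have heps i j : sigma <= (eL (i, j)).1.
  by have [->|->] := ord2_cases i; have [->|->] := ord2_cases j.
rewrite -sumrB mulr_suml; apply: le_trans (ler_norm_sum _ _ _) _.
apply: ler_sum => i _; rewrite -sumrB mulr_suml; apply: le_trans (ler_norm_sum _ _ _) _.
apply: ler_sum => j _; rewrite -mulrBl -mulrBr 2!normrM.
rewrite [leRHS]mulrAC ler_wpM2r// -[leRHS]mulrA ler_wpM2l//.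
by case: (eLP (i, j)) => _ _; exact.
Qed.

Lemma frameE (s : R) (i k : 'I_2) :
  frame gamma s i k =
  coord2 R i (if k == 0 then unit_tangent gamma s else unit_normal gamma s).
Proof.
rewrite /frame mxE; case: splitP => k' kE; rewrite !mxE /coord2.
  by rewrite (_ : k = 0)//; apply/val_inj; rewrite /= kE; case: k' kE => [[]].
by rewrite (_ : k = 1)//; apply/val_inj; rewrite /= kE; case: k' kE => [[]].
Qed.

Lemma in_frameE (S : 'M[R]_2) (s : R) (k l : 'I_2) :
  in_frame (frame gamma s) S k l =
  \sum_i \sum_j
    coord2 R i (if k == 0 then unit_tangent gamma s else unit_normal gamma s) * S i j *
    coord2 R j (if l == 0 then unit_tangent gamma s else unit_normal gamma s).
Proof.
rewrite /in_frame mxE exchange_big /=; apply: eq_bigr => j _.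
rewrite mxE mulr_suml; apply: eq_bigr => i _.
by rewrite mxE !frameE.
Qed.

Lemma in_frame_bigO (k l : 'I_2) (main : R -> R) :
  (forall sigma : R, main sigma = \sum_i \sum_j
     coord2 R i (if k == 0 then T else N) *
       ((2 * (coord2 R i T * coord2 R j T) / 3 * sigma
       + (coord2 R i T * coord2 R j T * m + 2 * quartic i j / 5) * sigma ^+ 3) / pi)
     * coord2 R j (if l == 0 then T else N)) ->
  (fun sigma : R => in_frame (frame gamma 0) (covariance_tensor alpha x sigma) k l
     - main sigma) =O_ (0^'+) (fun sigma : R => sigma ^+ 4).
Proof.
move=> mainE; have [eps [L [eps0 L0 asym]]] :=
  in_frame_asymptotics (if k == 0 then T else N) (if l == 0 then T else N).
apply/eqO_exP; exists (L + 1); first by rewrite ltr_wpDl.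
near=> sigma; rewrite in_frameE mainE.
have s0 : 0 < sigma by [].
have se : sigma <= eps by near: sigma; exact: nbhs_right_le.
apply: le_trans (asym sigma s0 se) _.
have s4 : 0 <= sigma ^+ 4 by rewrite exprn_ge0// ltW.
by rewrite (ger0_norm s4) ler_wpM2r// lerDl.
Unshelve. all: by end_near. Qed.

(** By orthonormality, T_i T_j contributes only to the entry (T, T), and [quartic] contracts to
    -kappa^2 / 3 on (T, T), kappa_s / 6 on the mixed pairs and kappa^2 / 4 on (N, N). The
    coefficients of sigma^3 follow: 1/12 - 2/15 = -1/20, then 2/5 times 1/6 and 2/5 times 1/4. Here
    [p] stands for pi. *)
Lemma main_terms (p sigma : R) : p != 0 ->
  let main u v := \sum_i \sum_j coord2 R i u *
       ((2 * (coord2 R i T * coord2 R j T) / 3 * sigma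
       + (coord2 R i T * coord2 R j T * m + 2 * quartic i j / 5) * sigma ^+ 3) / p)
     * coord2 R j v in
  [/\ 2 * sigma / (3 * p) - kappa ^+ 2 * sigma ^+ 3 / (20 * p) = main T T,
    kappa_s * sigma ^+ 3 / (15 * p) = main T N,
    kappa_s * sigma ^+ 3 / (15 * p) = main N T &
    kappa ^+ 2 * sigma ^+ 3 / (10 * p) = main N N].
Proof.
(* The identities are homogeneous of degree 4 in the tangent: they hold for any [T]
   once the left-hand sides are multiplied by |T|^4 = 1. *)
move=> p0 main; have := dot2_tangent.
rewrite /main /quartic /third !big_ord_recl !big_ord0 /coord2 /unit_normal /rot90 /dot2 /=.
case: T => [T1 T2] /=; rewrite /GRing.scale/= => TT.
split.
- transitivity ((2 * sigma / (3 * p) - kappa ^+ 2 * sigma ^+ 3 / (20 * p)) *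
    (T1 * T1 + T2 * T2) ^+ 2); first by rewrite TT expr1n mulr1.
  by field.
- transitivity (kappa_s * sigma ^+ 3 / (15 * p) * (T1 * T1 + T2 * T2) ^+ 2).
    by rewrite TT expr1n mulr1.
  by field.
- transitivity (kappa_s * sigma ^+ 3 / (15 * p) * (T1 * T1 + T2 * T2) ^+ 2).
    by rewrite TT expr1n mulr1.
  by field.
- transitivity (kappa ^+ 2 * sigma ^+ 3 / (10 * p) * (T1 * T1 + T2 * T2) ^+ 2).
    by rewrite TT expr1n mulr1.
  by field.
Qed.

End Covariance.

Theorem proposition1 (R : realType) (C : set (R * R))
    (alpha : {measure set (R * R) -> \bar R}) (x : R * R)
    (hC : smooth_plane_curve C) (halpha : arc_length_measure C alpha) (hx : C x)
    (a b : R) (gamma : R -> R * R)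
    (hgamma : arc_length_parametrization C a b gamma)
    (hab : a < 0 < b) (hgamma0 : gamma 0 = x) :
  let kappa := curvature gamma 0 in
  let kappa_s := curvature_s gamma 0 in
  let Sigma := fun sigma : R =>
    in_frame (frame gamma 0) (covariance_tensor alpha x sigma) in
  [/\ (fun sigma : R => Sigma sigma 0 0 -
         (2 * sigma / (3 * pi) - kappa ^+ 2 * sigma ^+ 3 / (20 * pi)))
        =O_ (0^'+) (fun sigma : R => sigma ^+ 4),
      (fun sigma : R => Sigma sigma 0 1 - kappa_s * sigma ^+ 3 / (15 * pi))
        =O_ (0^'+) (fun sigma : R => sigma ^+ 4),
      (fun sigma : R => Sigma sigma 1 0 - kappa_s * sigma ^+ 3 / (15 * pi))
        =O_ (0^'+) (fun sigma : R => sigma ^+ 4) &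
      (fun sigma : R => Sigma sigma 1 1 - kappa ^+ 2 * sigma ^+ 3 / (10 * pi))
        =O_ (0^'+) (fun sigma : R => sigma ^+ 4)].

Proof.
move=> kappa kappa_s Sigma; have pi0 : pi != 0 :> R by rewrite gt_eqF// pi_gt0.
split; apply: (in_frame_bigO _ C alpha x hC halpha a b gamma hgamma hab hgamma0 _ _ (fun sigma => _)) => sigma.
- by have [-> _ _ _] := main_terms _ C a b gamma hgamma hab pi sigma pi0.
- by have [_ -> _ _] := main_terms _ C a b gamma hgamma hab pi sigma pi0.
- by have [_ _ -> _] := main_terms _ C a b gamma hgamma hab pi sigma pi0.
- by have [_ _ _ ->] := main_terms _ C a b gamma hgamma hab pi sigma pi0.
Qed.
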